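(* Assume $\delta_1\ge\delta_2$ and $t>0$. Consider the formula $$\dim_HM_c(t)=\max\Big\{\delta_1+\frac{\delta_2\log b}{t+\log b},\ \delta_2+\frac{\delta_1\log a}{t+\log a}\Big\}.\qquad(\ast)$$ Then $(\ast)$ holds in each of the following cases: (1) $a\le b$; (2) $a>b$ and $\log a\le t+\log b$; (3) $a>b$, $\log a>t+\log b$ and $\delta_2(t+\log a)\ge\delta_1\log a$. In the remaining case $a>b$, $\log a>t+\log b$ and $\delta_2(t+\log a)<\delta_1\log a$, formula $(\ast)$ fails.
   Context: Let $a,b\ge3$ be integers, $\Lambda_a\subset\{0,\dots,a-1\}$, $\Lambda_b\subset\{0,\dots,b-1\}$ with at least two elements each, $\mathcal C_a$ (resp. $\mathcal C_b$) the attractor of $\{x\mapsto(x+k)/a:k\in\Lambda_a\}$ (resp. with $b,\Lambda_b$), and $\delta_1=\log\#\Lambda_a/\log a$, $\delta_2=\log\#\Lambda_b/\log b$. Fix $(x_o,y_o)\in\mathcal C_a\times\mathcal C_b$; $\|\cdot\|$ is the distance to the nearest integer. $M_c(t)=\{(x,y)\in\mathcal C_a\times\mathcal C_b:\|a^nx-x_o\|\cdot\|b^ny-y_o\|<e^{-nt}\text{ for infinitely many }n\in\mathbb N\}$. *)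

(* Defs.v *)
From Stdlib Require Import Reals Lra List.
Open Scope R_scope.

Definition dnint (x : R) : R :=
  Rmin (x - IZR (Int_part x)) (IZR (Int_part x) + 1 - x).

Definition digit_set (a : nat) (L : list nat) : Prop :=
  NoDup L /\ (forall k, In k L -> (k < a)%nat) /\ (2 <= length L)%nat.

Definition is_attractor (a : nat) (L : list nat) (K : R -> Prop) : Prop :=
  (exists x, K x) /\ compact K /\
  (forall x, K x <-> exists k y, In k L /\ K y /\ x = (y + INR k) / INR a).

Definition dist2 (p q : R * R) : R :=
  sqrt ((fst p - fst q) ^ 2 + (snd p - snd q) ^ 2).

Definition diam_le (U : R * R -> Prop) (r : R) : Prop :=
  forall p q, U p -> U q -> dist2 p q <= r.

(* r^s with the convention 0^s = 0 (only used for s > 0). *)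
Definition rpow (r s : R) : R := if Req_EM_T r 0 then 0 else Rpower r s.

(* H^s_delta(E) = 0: for every eps > 0 there is a countable delta-cover
   (U_n) of E with sum_n diam(U_n)^s < eps.  Here r_n is any number with
   diam(U_n) <= r_n <= delta; the infimum over such pairs is the same as
   the infimum of sum diam(U_n)^s. *)
Definition Hs_delta_null (s delta : R) (E : R * R -> Prop) : Prop :=
  forall eps, 0 < eps ->
    exists (U : nat -> R * R -> Prop) (r : nat -> R) (l : R),
      (forall p, E p -> exists n, U n p) /\
      (forall n, 0 <= r n <= delta /\ diam_le (U n) (r n)) /\
      infinite_sum (fun n => rpow (r n) s) l /\ l < eps.

Definition Hs_null (s : R) (E : R * R -> Prop) : Prop :=
  forall delta, 0 < delta -> Hs_delta_null s delta E.

(* dim_H E = d : d is the infimum of {s > 0 : H^s(E) = 0}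
   (this set is upward closed, so this is inf {s >= 0 : H^s(E) = 0}). *)
Definition hausdorff_dim (E : R * R -> Prop) (d : R) : Prop :=
  (forall s, 0 < s -> Hs_null s E -> d <= s) /\
  (forall d', (forall s, 0 < s -> Hs_null s E -> d' <= s) -> d' <= d).

Definition Mc (a b : nat) (Ca Cb : R -> Prop) (xo yo t : R) (p : R * R) : Prop :=
  Ca (fst p) /\ Cb (snd p) /\
  forall N : nat, exists n : nat, (N <= n)%nat /\
    dnint (INR a ^ n * fst p - xo) * dnint (INR b ^ n * snd p - yo)
      < exp (- (INR n * t)).

(* Main.v *)
Require Import Defs.
From Stdlib Require Import Reals List Lra Lia ZArith ClassicalEpsilon.
Open Scope R_scope.

(* Write al = ln a, be = ln b and ||.|| for [dnint].

   Upper bound: if ||a^n x - xo|| ||b^n y - yo|| < e^(-nt), then, up to a small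
   loss, the factors are at most e^(-ns) and e^(-n(t-s)) for some s of a fixed
   finite grid of [0,t]. For fixed s these points form about a^(n d1) b^(n d2)
   rectangles with sides e^(-n(al+s)) and e^(-n(be+t-s)); covering them by squares
   whose side e^(-n rho) is the smaller of the two costs the exponent
   (d1 (rho-s) + d2 (rho-t+s)) / rho, which is at most F in cases (1)-(3).

   Lower bound: fix s, a sparse sequence n_k = M^(k+1), and force the digits of x
   (resp. y) right after position n_k to copy those of xo (resp. yo) for about
   n_k s / al (resp. n_k (t-s) / be) positions. The uniform measure on the
   remaining points satisfies mu(U) <= C diam(U)^sg for all sg below the minimum
   over the scales e^(-n rho) of the local exponent. For s = 0 and s = t this
   gives the two terms of F. In the remaining case the exponents at the scales
   rho = al+s and rho = be+t-s are respectively decreasing and increasing in s,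
   and they cross strictly inside (0,t), at a value larger than F. *)

(** * Digit expansions of points of an attractor *)

(** No measure is constructed for the lower bound. Masses are finite averages over digit trees, and
    the mass distribution principle becomes a contradiction: a cover whose total cost is too small
    leaves a branch of the tree whose limit lies in none of its sets, although that limit belongs to
    [Mc]. Only partial sums and an averaging argument at each node are involved.

    The sequence n_k can be merely geometric because the forced blocks before n_k have total length
    O(n_k / M): [M] is taken so large, in terms of the gap between the claimed exponent and [sg],
    that the gap absorbs this loss. The other errors are bounded factors, which come from rounding
    scales to powers of a and b.

    The two bases never have to be synchronised: one step of the tree adds one digit to each
    coordinate, so its cells are rectangles a^-i by b^-i, and the mass of a product set is a product
    of averages. A covering set of scale e^-rate is then measured at two different levels, one for
    each base.

    To refute the formula, a lower bound exceeding F is enough; the dimension in the remaining case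
    is not computed. *)

Lemma fun_choice {S T : Type} (P : S -> T -> Prop) :
  (forall x, exists y, P x y) -> exists f : S -> T, forall x, P x (f x).
Proof.
  intros h. exists (fun x => proj1_sig (constructive_indefinite_description _ (h x))).
  intros x. exact (proj2_sig (constructive_indefinite_description _ (h x))).
Qed.

Lemma Rabs_le_bounds (x e : R) : Rabs x <= e -> - e <= x <= e.
Proof.
  intros h. pose proof (Rle_abs x). pose proof (Rle_abs (- x)) as h'.
  rewrite Rabs_Ropp in h'. lra.
Qed.

Lemma dnint_nonneg (x : R) : 0 <= dnint x.
Proof.
  unfold dnint. destruct (base_Int_part x) as [h1 h2].
  apply Rmin_glb; lra.
Qed.

Lemma dnint_le_1 (x : R) : dnint x <= 1.
Proof.
  unfold dnint. destruct (base_Int_part x) as [h1 h2].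
  eapply Rle_trans; [apply Rmin_l | lra].
Qed.

Lemma dnint_le_dist (x : R) (z : Z) : dnint x <= Rabs (x - IZR z).
Proof.
  unfold dnint. destruct (base_Int_part x) as [h1 h2].
  destruct (Z_le_gt_dec z (Int_part x)) as [h | h].
  - apply IZR_le in h. eapply Rle_trans; [apply Rmin_l |].
    rewrite Rabs_right; lra.
  - assert (h' : (Int_part x + 1 <= z)%Z) by lia.
    apply IZR_le in h'. rewrite plus_IZR in h'.
    eapply Rle_trans; [apply Rmin_r |].
    rewrite Rabs_left1; lra.
Qed.

Lemma dnint_attained (x : R) : exists z : Z, Rabs (x - IZR z) = dnint x.
Proof.
  unfold dnint. destruct (base_Int_part x) as [h1 h2].
  destruct (Rle_dec (x - IZR (Int_part x)) (IZR (Int_part x) + 1 - x)) as [h | h].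
  - exists (Int_part x). rewrite Rmin_left, Rabs_right; lra.
  - exists (Int_part x + 1)%Z. rewrite plus_IZR, Rmin_right, Rabs_left1; lra.
Qed.

Lemma nat_floor (x : R) : 0 <= x -> exists m : nat, INR m <= x < INR m + 1.
Proof.
  intros hx. destruct (base_Int_part x) as [h1 h2].
  assert (h0 : (0 <= Int_part x)%Z).
  { assert (-1 < Int_part x)%Z; [| lia]. apply lt_IZR. lra. }
  exists (Z.to_nat (Int_part x)).
  rewrite INR_IZR_INZ, Z2Nat.id by assumption. lra.
Qed.

Lemma INR_gt_1 (a : nat) : (2 <= a)%nat -> 1 < INR a.
Proof. intros h. apply le_INR in h. simpl in h. lra. Qed.

Lemma ln_pos (x : R) : 1 < x -> 0 < ln x.
Proof. intros h. rewrite <- ln_1. apply ln_increasing; lra. Qed.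

Lemma pow_exp_ln (x : R) (m : nat) : 0 < x -> x ^ m = exp (INR m * ln x).
Proof.
  intros hx. rewrite <- (exp_ln (x ^ m)) by (apply pow_lt; lra).
  rewrite ln_pow by lra. reflexivity.
Qed.

Lemma inv_pow_exp_ln (x : R) (m : nat) : 0 < x -> / x ^ m = exp (- (INR m * ln x)).
Proof. intros hx. rewrite exp_Ropp, pow_exp_ln; auto. Qed.

Lemma exp_le (x y : R) : x <= y -> exp x <= exp y.
Proof. intros [h | ->]; [left; apply exp_increasing; lra | lra]. Qed.

(** * Finite sums of reals over lists *)

Definition lsum {T : Type} (f : T -> R) (l : list T) : R :=
  fold_right Rplus 0 (map f l).

Lemma lsum_cons {T : Type} (f : T -> R) (x : T) (l : list T) :
  lsum f (x :: l) = f x + lsum f l.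
Proof. reflexivity. Qed.

Lemma lsum_nil {T : Type} (f : T -> R) : lsum f nil = 0.
Proof. reflexivity. Qed.

Lemma lsum_app {T : Type} (f : T -> R) (l l' : list T) :
  lsum f (l ++ l') = lsum f l + lsum f l'.
Proof.
  induction l as [| x l IH]; [unfold lsum; simpl; lra |].
  simpl. rewrite !lsum_cons, IH. lra.
Qed.

Lemma lsum_map {S T : Type} (g : S -> T) (f : T -> R) (l : list S) :
  lsum f (map g l) = lsum (fun x => f (g x)) l.
Proof. unfold lsum. rewrite map_map. reflexivity. Qed.

Lemma lsum_le {T : Type} (f g : T -> R) (l : list T) :
  (forall x, In x l -> f x <= g x) -> lsum f l <= lsum g l.
Proof.
  induction l as [| x l IH]; intros h; [unfold lsum; simpl; lra |].
  rewrite !lsum_cons. apply Rplus_le_compat.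
  - apply h; left; reflexivity.
  - apply IH; intros y hy; apply h; right; assumption.
Qed.

Lemma lsum_ext {T : Type} (f g : T -> R) (l : list T) :
  (forall x, In x l -> f x = g x) -> lsum f l = lsum g l.
Proof. intros h. unfold lsum. f_equal. apply map_ext_in, h. Qed.

Lemma lsum_const {T : Type} (c : R) (l : list T) :
  lsum (fun _ => c) l = INR (length l) * c.
Proof.
  induction l as [| x l IH]; [unfold lsum; simpl; lra |].
  rewrite lsum_cons, IH. change (length (x :: l)) with (S (length l)).
  rewrite S_INR. lra.
Qed.

Lemma lsum_scal {T : Type} (c : R) (f : T -> R) (l : list T) :
  lsum (fun x => c * f x) l = c * lsum f l.
Proof.
  induction l as [| x l IH]; [unfold lsum; simpl; lra |].
  rewrite !lsum_cons, IH. lra.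
Qed.

Lemma lsum_plus {T : Type} (f g : T -> R) (l : list T) :
  lsum (fun x => f x + g x) l = lsum f l + lsum g l.
Proof.
  induction l as [| x l IH]; [unfold lsum; simpl; lra |].
  rewrite !lsum_cons, IH. lra.
Qed.

Lemma lsum_nonneg {T : Type} (f : T -> R) (l : list T) :
  (forall x, In x l -> 0 <= f x) -> 0 <= lsum f l.
Proof.
  intros h. replace 0 with (lsum (fun _ : T => 0) l).
  - apply lsum_le, h.
  - rewrite lsum_const. lra.
Qed.

Lemma lsum_exchange {S T : Type} (f : S -> T -> R) (l : list S) (l' : list T) :
  lsum (fun x => lsum (f x) l') l = lsum (fun y => lsum (fun x => f x y) l) l'.
Proof.
  induction l as [| x l IH].
  - unfold lsum at 1. simpl. symmetry. rewrite <- (Rmult_0_r (INR (length l'))).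
    rewrite <- lsum_const. reflexivity.
  - rewrite lsum_cons, IH, <- lsum_plus. reflexivity.
Qed.

Lemma lsum_flat_map {S T : Type} (g : S -> list T) (f : T -> R) (l : list S) :
  lsum f (flat_map g l) = lsum (fun x => lsum f (g x)) l.
Proof.
  induction l as [| x l IH]; [reflexivity |].
  simpl. rewrite lsum_app, lsum_cons, IH. reflexivity.
Qed.

Lemma sum_f_R0_lsum (f : nat -> R) (n : nat) :
  sum_f_R0 f n = lsum f (seq 0 (S n)).
Proof.
  induction n as [| n IH]; [unfold lsum; simpl; lra |].
  rewrite seq_S, lsum_app, <- IH. unfold lsum. simpl. lra.
Qed.

Lemma lsum_seq_mono (f : nat -> R) (n m : nat) :
  (forall i, 0 <= f i) -> (n <= m)%nat -> lsum f (seq 0 n) <= lsum f (seq 0 m).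
Proof.
  intros hf h. replace m with (n + (m - n))%nat by lia.
  rewrite seq_app, lsum_app.
  assert (0 <= lsum f (seq (0 + n) (m - n))) by (apply lsum_nonneg; auto). lra.
Qed.

Lemma lsum_geom (C q : R) (n m : nat) :
  0 <= q < 1 -> 0 <= C ->
  lsum (fun i => C * q ^ (n + i)) (seq 0 m) <= C * q ^ n / (1 - q).
Proof.
  intros hq hC.
  assert (H : lsum (fun i => C * q ^ (n + i)) (seq 0 m) = C * q ^ n * (1 - q ^ m) / (1 - q)).
  { induction m as [| m IH]; [unfold lsum; simpl; field; lra |].
    rewrite seq_S, lsum_app, IH, lsum_cons. unfold lsum. simpl.
    rewrite pow_add. field. lra. }
  rewrite H. apply Rmult_le_compat_r; [left; apply Rinv_0_lt_compat; lra |].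
  assert (0 <= q ^ n) by (apply pow_le; lra).
  assert (0 <= q ^ m) by (apply pow_le; lra).
  assert (0 <= C * q ^ n) by (apply Rmult_le_pos; lra). nra.
Qed.

(** * Cells, words and addresses *)

Lemma attractor_unit (a : nat) (L : list nat) (K : R -> Prop) (x : R) :
  (2 <= a)%nat -> (forall k, In k L -> (k < a)%nat) -> is_attractor a L K ->
  K x -> 0 <= x <= 1.
Proof.
  intros ha hL [hne [hc hK]] hx.
  pose proof (INR_gt_1 a ha) as ha1.
  (* The supremum [S] of [E] tells how far [K] sticks out of [0,1] on either side. Writing a point
     of [K] as the image of another one divides this excess by [a], so S <= S / a and S <= 0. *)
  set (E := fun z => exists x, K x /\ (z = x - 1 \/ z = - x)).
  destruct (completeness E) as [S [hS1 hS2]].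
  - destruct (compact_P1 K hc) as [m [M hM]].
    exists (Rabs m + Rabs M). intros z [y [hy hz]].
    specialize (hM y hy). pose proof (Rle_abs M). pose proof (Rle_abs (- m)).
    pose proof (Rabs_pos m). pose proof (Rabs_pos M).
    rewrite Rabs_Ropp in *. destruct hz; lra.
  - exists (x - 1), x. auto.
  - assert (hS : S <= S / INR a).
    { apply hS2. intros z [y [hy hz]].
      destruct (proj1 (hK y) hy) as [k [y' [hk [hy' hyy]]]].
      assert (h1 : y' - 1 <= S) by (apply hS1; exists y'; auto).
      assert (h2 : - y' <= S) by (apply hS1; exists y'; auto).
      assert (h3 : INR k <= INR a - 1).
      { apply hL in hk. apply le_INR in hk. rewrite S_INR in hk. lra. }
      pose proof (pos_INR k).
      apply Rmult_le_reg_r with (INR a); [lra |].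
      replace (S / INR a * INR a) with S by (field; lra).
      assert (hya : y * INR a = y' + INR k) by (rewrite hyy; field; lra).
      destruct hz; nra. }
    assert (hS0 : S <= 0).
    { assert (S * INR a <= S).
      { replace S with (S / INR a * INR a) at 2 by (field; lra).
        apply Rmult_le_compat_r; lra. }
      nra. }
    assert (h1 : x - 1 <= S) by (apply hS1; exists x; auto).
    assert (h2 : - x <= S) by (apply hS1; exists x; auto).
    lra.
Qed.

Lemma compact_adherent (K : R -> Prop) (x : R) :
  compact K -> (forall eps, 0 < eps -> exists y, K y /\ Rabs (y - x) < eps) -> K x.
Proof.
  intros hc h. apply NNPP. intros hx.
  destruct (compact_P2 K hc x hx) as [d hd].
  destruct (h d (cond_pos d)) as [y [hy hyx]].
  exact (hd y hyx hy).
Qed.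

Fixpoint words (a : nat) (L : list nat) (n : nat) : list nat :=
  match n with
  | O => 0%nat :: nil
  | S n => map (fun p => fst p * a ^ n + snd p)%nat (list_prod L (words a L n))
  end.

Lemma words_length (a : nat) (L : list nat) (n : nat) :
  length (words a L n) = (length L ^ n)%nat.
Proof.
  induction n as [| n IH]; [reflexivity |].
  simpl. rewrite length_map, length_prod, IH. reflexivity.
Qed.

Lemma attractor_words (a : nat) (L : list nat) (K : R -> Prop) (n : nat) :
  (2 <= a)%nat -> is_attractor a L K ->
  forall x, K x -> exists W y, In W (words a L n) /\ K y /\ x = (INR W + y) / INR a ^ n.
Proof.
  intros ha [hne [hc hK]]. pose proof (INR_gt_1 a ha) as ha1.
  induction n as [| n IH]; intros x hx.
  - exists 0%nat, x. simpl. split; [auto | split; [auto | field]].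
  - destruct (proj1 (hK x) hx) as [k [y [hk [hy hxy]]]].
    destruct (IH y hy) as [W [z [hW [hz hyz]]]].
    exists (k * a ^ n + W)%nat, z. split; [| split; auto].
    + simpl. apply in_map_iff. exists (k, W). split; [reflexivity |].
      apply in_prod; assumption.
    + rewrite hxy, hyz, plus_INR, mult_INR, pow_INR. simpl. field.
      split; [apply pow_nonzero |]; lra.
Qed.

(** [words] puts a new digit in front, as unfolding the attractor equation does. Here the new digit
    goes to the end, so that [horner a k n] is the numerator of the level-[n] cell reached by the
    digits [k]. *)
Fixpoint horner (a : nat) (k : nat -> nat) (n : nat) : nat :=
  match n with
  | O => 0%nat
  | S n => (a * horner a k n + k n)%nat
  end.

Lemma attractor_address (a : nat) (L : list nat) (K : R -> Prop) (x : R) :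
  (2 <= a)%nat -> (forall k, In k L -> (k < a)%nat) -> is_attractor a L K -> K x ->
  exists e : nat -> nat, (forall i, In (e i) L) /\
    forall n, INR (horner a e n) <= INR a ^ n * x <= INR (horner a e n) + 1.
Proof.
  intros ha hL hKK hx. pose proof (INR_gt_1 a ha) as ha1.
  pose proof (fun y => attractor_unit a L K y ha hL hKK) as hunit.
  destruct hKK as [hne [hc hK]].
  assert (step : forall y : {y | K y}, {p : nat * {y | K y} |
      In (fst p) L /\ proj1_sig y = (proj1_sig (snd p) + INR (fst p)) / INR a}).
  { intros [y hy]. apply constructive_indefinite_description.
    destruct (proj1 (hK y) hy) as [k [z [hk [hz hyz]]]].
    exists (k, exist _ z hz). auto. }
  (* [orb n] is the remainder of a^n x after its first [n] digits are removed. It stays in [K],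
     hence in [0,1], which gives the two closed inequalities. *)
  pose (orb := fix orb n := match n with
               | O => exist K x hx
               | S n => snd (proj1_sig (step (orb n))) end).
  exists (fun n => fst (proj1_sig (step (orb n)))).
  split.
  - intros i. destruct (step (orb i)) as [p [hp1 hp2]]. exact hp1.
  - intros n.
    assert (H : INR a ^ n * x =
      INR (horner a (fun n => fst (proj1_sig (step (orb n)))) n) + proj1_sig (orb n)).
    { induction n as [| n IH]; [simpl; ring |].
      change (orb (S n)) with (snd (proj1_sig (step (orb n)))).
      simpl horner. rewrite plus_INR, mult_INR. simpl pow.
      rewrite Rmult_assoc, IH.
      destruct (proj2_sig (step (orb n))) as [_ hp].
      rewrite Rmult_plus_distr_l, Rplus_assoc. f_equal.
      transitivity (INR a * ((proj1_sig (snd (proj1_sig (step (orb n)))) +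
        INR (fst (proj1_sig (step (orb n))))) / INR a)); [f_equal; exact hp |].
      assert (hf : forall u v, INR a * ((u + v) / INR a) = v + u) by (intros; field; lra).
      apply hf. }
    rewrite H. pose proof (hunit _ (proj2_sig (orb n))). lra.
Qed.

(** The point is the supremum of the left endpoints of the nested cells. It belongs to [K] by
    compactness: the image of any [y0] in [K] under the first [n] maps lies in [K] and in the
    level-[n] cell, within a^-n of it. *)
Lemma attractor_limit (a : nat) (L : list nat) (K : R -> Prop) (k : nat -> nat) :
  (2 <= a)%nat -> (forall j, In j L -> (j < a)%nat) -> is_attractor a L K ->
  (forall i, In (k i) L) ->
  exists x, K x /\
    forall n, INR (horner a k n) <= INR a ^ n * x <= INR (horner a k n) + 1.
Proof.
  intros ha hL hKK hk. pose proof (INR_gt_1 a ha) as ha1.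
  pose proof (fun y => attractor_unit a L K y ha hL hKK) as hunit.
  destruct hKK as [[y0 hy0] [hc hK]].
  assert (hpos : forall n, 0 < INR a ^ n) by (intros n; apply pow_lt; lra).
  assert (hstep : forall n, INR (horner a k (S n)) = INR a * INR (horner a k n) + INR (k n)).
  { intros n. simpl. rewrite plus_INR, mult_INR. reflexivity. }
  assert (hkn : forall n, 0 <= INR (k n) <= INR a - 1).
  { intros n. split; [apply pos_INR |]. specialize (hL _ (hk n)).
    apply le_INR in hL. rewrite S_INR in hL. lra. }
  set (h := fun n => INR (horner a k n)).
  assert (hnest : forall n j, h n * INR a ^ j <= h (n + j)%nat <= (h n + 1) * INR a ^ j - 1).
  { intros n j. induction j as [| j IH]; [rewrite Nat.add_0_r; simpl; lra |].
    rewrite Nat.add_succ_r. unfold h in *. rewrite hstep. simpl pow.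
    pose proof (hkn (n + j)%nat). split; nra. }
  (* Every left endpoint is below every right endpoint, whichever level is deeper; so the supremum
     lies in all the cells. *)
  assert (hub : forall n m, h m <= INR a ^ m * ((h n + 1) / INR a ^ n)).
  { intros n m. destruct (Nat.le_ge_cases n m) as [hnm | hnm].
    - destruct (hnest n (m - n)%nat) as [_ h2].
      replace (n + (m - n))%nat with m in h2 by lia.
      replace (INR a ^ m) with (INR a ^ n * INR a ^ (m - n)).
      2:{ rewrite <- pow_add. f_equal. lia. }
      field_simplify; [nra |]. apply Rgt_not_eq, hpos.
    - destruct (hnest m (n - m)%nat) as [h1 _].
      replace (m + (n - m))%nat with n in h1 by lia.
      replace (INR a ^ n) with (INR a ^ m * INR a ^ (n - m)).
      2:{ rewrite <- pow_add. f_equal. lia. }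
      pose proof (hpos (n - m)%nat). pose proof (hpos m).
      replace (INR a ^ m * ((h n + 1) / (INR a ^ m * INR a ^ (n - m))))
        with ((h n + 1) / INR a ^ (n - m)) by (field; lra).
      apply Rmult_le_reg_r with (INR a ^ (n - m)); [lra |].
      replace ((h n + 1) / INR a ^ (n - m) * INR a ^ (n - m)) with (h n + 1) by (field; lra).
      lra. }
  destruct (completeness (fun z => exists n, z = h n / INR a ^ n)) as [x [hx1 hx2]].
  - exists (h 0%nat + 1). intros z [n ->]. specialize (hub 0%nat n).
    pose proof (hpos n). apply Rmult_le_reg_l with (INR a ^ n); [lra |].
    simpl pow in hub at 2. replace ((h 0%nat + 1) / 1) with (h 0%nat + 1) in hub by field.
    replace (INR a ^ n * (h n / INR a ^ n)) with (h n) by (field; lra). lra.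
  - exists (h 0%nat / INR a ^ 0), 0%nat. reflexivity.
  - assert (hmain : forall n, h n <= INR a ^ n * x <= h n + 1).
    { intros n. pose proof (hpos n). split.
      - replace (h n) with (INR a ^ n * (h n / INR a ^ n)) by (field; lra).
        apply Rmult_le_compat_l; [lra |]. apply hx1. exists n. reflexivity.
      - replace (h n + 1) with (INR a ^ n * ((h n + 1) / INR a ^ n)) by (field; lra).
        apply Rmult_le_compat_l; [lra |]. apply hx2. intros z [m ->].
        pose proof (hpos m). apply Rmult_le_reg_l with (INR a ^ m); [lra |].
        replace (INR a ^ m * (h m / INR a ^ m)) with (h m) by (field; lra).
        apply hub. }
    exists x. split; [| exact hmain].
    assert (hin : forall n y, K y -> K ((h n + y) / INR a ^ n)).
    { induction n as [| n IH]; intros y hy.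
      - unfold h. simpl. replace ((0 + y) / 1) with y by field. exact hy.
      - replace ((h (S n) + y) / INR a ^ S n)
          with ((h n + (y + INR (k n)) / INR a) / INR a ^ n).
        + apply IH. apply hK. exists (k n), y. auto.
        + unfold h. rewrite hstep. simpl. field. pose proof (hpos n). split; lra. }
    apply compact_adherent; [exact hc |]. intros eps heps.
    destruct (pow_lt_1_zero (/ INR a)) with (y := eps) as [N hN]; auto.
    { rewrite Rabs_right; [| apply Rle_ge; left; apply Rinv_0_lt_compat; lra].
      rewrite <- Rinv_1. apply Rinv_lt_contravar; lra. }
    exists ((h N + y0) / INR a ^ N). split; [apply hin, hy0 |].
    eapply Rle_lt_trans; [| apply (hN N); lia].
    rewrite pow_inv. pose proof (hpos N).
    assert (0 < / INR a ^ N) by (apply Rinv_0_lt_compat; lra).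
    rewrite (Rabs_right (/ _)) by lra.
    pose proof (hmain N). pose proof (hunit y0 hy0).
    replace ((h N + y0) / INR a ^ N - x) with (/ INR a ^ N * (h N + y0 - INR a ^ N * x))
      by (field; lra).
    rewrite Rabs_mult, (Rabs_right (/ _)) by lra.
    rewrite <- (Rmult_1_r (/ INR a ^ N)) at 2.
    apply Rmult_le_compat_l; [lra |]. apply Rabs_le. lra.
Qed.

(** * Coverings *)

(** [m] is the level of base-[a] cells that matches the scale e^-x: a^-(m+1) < e^-x <= a^-m. *)
Lemma pow_floor (a : nat) (x : R) :
  (2 <= a)%nat -> 0 <= x ->
  exists m : nat, INR m * ln (INR a) <= x < (INR m + 1) * ln (INR a).
Proof.
  intros ha hx. pose proof (ln_pos _ (INR_gt_1 a ha)) as hl.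
  destruct (nat_floor (x / ln (INR a))) as [m hm].
  { apply Rmult_le_pos; [lra | left; apply Rinv_0_lt_compat; lra]. }
  exists m. replace x with (x / ln (INR a) * ln (INR a)) by (field; lra).
  split; [apply Rmult_le_compat_r | apply Rmult_lt_compat_r]; lra.
Qed.

(* A point of [K] whose orbit is close to [x0] at time [n] has free digits up
   to [n], then [q] digits with boundedly many choices, then free digits. *)
Lemma near_cover (a : nat) (L : list nat) (K : R -> Prop) (x0 : R) (n q j : nat) :
  (2 <= a)%nat -> (forall k, In k L -> (k < a)%nat) -> is_attractor a L K -> K x0 ->
  exists l : list R,
    length l = (25 * length L ^ (n + j))%nat /\
    forall x, K x -> dnint (INR a ^ n * x - x0) <= / INR a ^ q ->
      exists c, In c l /\ c <= x <= c + / INR a ^ (n + q + j).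
Proof.
  intros ha hL hK hx0. pose proof (INR_gt_1 a ha) as ha1.
  pose proof (fun y => attractor_unit a L K y ha hL hK) as hunit.
  pose proof (hunit x0 hx0) as hu0.
  (* The 25 is 5 * 5. The orbit point [y] is within 1 of [x0 + z'] with both [y] and [x0] in [0,1],
     so [z'] has five possible values. Given [z'], the middle [q] digits form an integer at distance
     at most 2 from the floor of a^q (x0 + z'). *)
  set (Z5 := (-2 :: -1 :: 0 :: 1 :: 2 :: nil)%Z).
  assert (hZ5 : forall z, (-2 <= z <= 2)%Z -> In z Z5).
  { intros z hz. assert (h : (z = -2 \/ z = -1 \/ z = 0 \/ z = 1 \/ z = 2)%Z) by lia.
    simpl. intuition. }
  exists (map (fun p : (nat * nat) * (Z * Z) =>
            INR (fst (fst p)) / INR a ^ n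
            + IZR (Int_part (INR a ^ q * (x0 + IZR (fst (snd p)))) + snd (snd p)) / INR a ^ (n + q)
            + INR (snd (fst p)) / INR a ^ (n + q + j))
         (list_prod (list_prod (words a L n) (words a L j)) (list_prod Z5 Z5))).
  split.
  { rewrite length_map, !length_prod, !words_length, Nat.pow_add_r. simpl. lia. }
  intros x hx hxd.
  destruct (attractor_words a L K n ha hK x hx) as [W [y [hW [hy hxy]]]].
  destruct (attractor_words a L K q ha hK y hy) as [Q [y' [_ [hy' hyy']]]].
  destruct (attractor_words a L K j ha hK y' hy') as [V [y'' [hV [hy'' hyy'']]]].
  pose proof (hunit y hy) as hu1. pose proof (hunit y' hy') as hu2.
  pose proof (hunit y'' hy'') as hu3.
  assert (hpn : 0 < INR a ^ n) by (apply pow_lt; lra).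
  assert (hpq : 1 <= INR a ^ q) by (apply pow_R1_Rle; lra).
  assert (hpj : 0 < INR a ^ j) by (apply pow_lt; lra).
  assert (hax : INR a ^ n * x = INR W + y) by (rewrite hxy; field; lra).
  assert (hiq : 0 < / INR a ^ q <= 1).
  { split; [apply Rinv_0_lt_compat; lra |].
    rewrite <- Rinv_1. apply Rinv_le_contravar; lra. }
  destruct (dnint_attained (INR a ^ n * x - x0)) as [z hz].
  rewrite <- hz, hax in hxd. clear hz.
  pose (z' := (z - Z.of_nat W)%Z).
  assert (hd : Rabs (y - x0 - IZR z') <= / INR a ^ q).
  { unfold z'. rewrite minus_IZR, <- INR_IZR_INZ.
    replace (y - x0 - (IZR z - INR W)) with (INR W + y - x0 - IZR z) by ring. exact hxd. }
  apply Rabs_le_bounds in hd.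
  assert (hz' : (-2 <= z' <= 2)%Z).
  { split; apply le_IZR; lra. }
  set (fl := Int_part (INR a ^ q * (x0 + IZR z'))).
  pose (d := (Z.of_nat Q - fl)%Z).
  assert (hd2 : (-2 <= d <= 2)%Z).
  { destruct (base_Int_part (INR a ^ q * (x0 + IZR z'))) as [f1 f2].
    assert (hQ : INR a ^ q * y = INR Q + y') by (rewrite hyy'; field; lra).
    assert (hp : -1 <= INR a ^ q * (y - x0 - IZR z') <= 1).
    { assert (h1 : INR a ^ q * / INR a ^ q = 1) by (apply Rinv_r; lra). split; nra. }
    fold fl in f1, f2.
    assert (-3 < d < 3)%Z; [| lia].
    unfold d. split; apply lt_IZR; rewrite minus_IZR, <- INR_IZR_INZ; nra. }
  exists (INR W / INR a ^ n + IZR (fl + d) / INR a ^ (n + q) + INR V / INR a ^ (n + q + j)).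
  split.
  - apply in_map_iff. exists ((W, V), (z', d)). split; [reflexivity |].
    repeat apply in_prod; auto.
  - unfold d. replace (fl + (Z.of_nat Q - fl))%Z with (Z.of_nat Q) by lia.
    rewrite <- INR_IZR_INZ.
    replace x with (INR W / INR a ^ n + INR Q / INR a ^ (n + q)
      + INR V / INR a ^ (n + q + j) + y'' * / INR a ^ (n + q + j)).
    + assert (0 < / INR a ^ (n + q + j)) by (apply Rinv_0_lt_compat, pow_lt; lra). nra.
    + rewrite hxy, hyy', hyy'', !pow_add. field. lra.
Qed.

(** With [q] and [m] the levels of the scales e^(-ns) and e^(-n rho), the free digits number m - q.
    Rounding [q] down costs the factor [length L] in the count, rounding [m] down the factor [a] in
    the width. *)
Lemma near_cover_rate (a : nat) (L : list nat) (K : R -> Prop) (x0 : R) (n : nat) (s rho : R) :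
  (2 <= a)%nat -> (forall k, In k L -> (k < a)%nat) -> (1 <= length L)%nat ->
  is_attractor a L K -> K x0 ->
  0 <= s -> ln (INR a) + s <= rho ->
  exists l : list R,
    INR (length l) <= 25 * INR (length L) *
      exp (INR n * (ln (INR (length L)) / ln (INR a) * (rho - s))) /\
    forall x, K x -> dnint (INR a ^ n * x - x0) <= exp (- (INR n * s)) ->
      exists c, In c l /\ c <= x <= c + INR a * exp (- (INR n * rho)).
Proof.
  intros ha hL hL1 hK hx0 hs hrho. pose proof (INR_gt_1 a ha) as ha1.
  pose proof (ln_pos _ ha1) as hl. pose proof (pos_INR n) as hn.
  assert (hA : 1 <= INR (length L)) by (apply le_INR in hL1; exact hL1).
  destruct (pow_floor a (INR n * s) ha) as [q hq]; [nra |].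
  destruct (pow_floor a (INR n * rho) ha) as [m hm]; [nra |].
  (* The target width is at most the width of the constrained piece; this is what leaves m - n - q
     >= 0 digits at the end. *)
  assert (hnqm : (n + q <= m)%nat).
  { apply Nat.lt_succ_r. apply INR_lt. rewrite S_INR, plus_INR. nra. }
  destruct (near_cover a L K x0 n q (m - n - q) ha hL hK hx0) as [l [hl1 hl2]].
  exists l. split.
  - rewrite hl1, mult_INR, pow_INR, Rmult_assoc.
    replace (INR 25) with 25 by (simpl; ring).
    apply Rmult_le_compat_l; [lra |].
    set (lA := ln (INR (length L))).
    assert (hlA : 0 <= lA).
    { unfold lA. rewrite <- ln_1. destruct hA as [hA | <-]; [left; apply ln_increasing; lra | lra]. }
    rewrite pow_exp_ln by lra. fold lA.
    rewrite <- (exp_ln (INR (length L))) by lra. fold lA. rewrite <- exp_plus.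
    apply exp_le.
    assert (hk : INR (n + (m - n - q)) * ln (INR a) <= ln (INR a) + INR n * (rho - s)).
    { replace (n + (m - n - q))%nat with (m - q)%nat by lia.
      rewrite minus_INR by lia. nra. }
    replace (lA + INR n * (lA / ln (INR a) * (rho - s)))
      with (lA / ln (INR a) * (ln (INR a) + INR n * (rho - s))) by (field; lra).
    replace (INR (n + (m - n - q)) * lA)
      with (lA / ln (INR a) * (INR (n + (m - n - q)) * ln (INR a))) by (field; lra).
    apply Rmult_le_compat_l; [| lra].
    apply Rmult_le_pos; [lra | left; apply Rinv_0_lt_compat; lra].
  - intros x hx hxd. destruct (hl2 x hx) as [c [hc1 hc2]].
    + eapply Rle_trans; [exact hxd |]. rewrite inv_pow_exp_ln by lra. apply exp_le. lra.
    + exists c. split; [exact hc1 |].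
      assert (/ INR a ^ (n + q + (m - n - q)) <= INR a * exp (- (INR n * rho))); [| lra].
      replace (n + q + (m - n - q))%nat with m by lia.
      rewrite inv_pow_exp_ln by lra. rewrite <- (exp_ln (INR a)) at 2 by lra.
      rewrite <- exp_plus. apply exp_le. nra.
Qed.

(** * Null sets from lists of covering squares *)

Lemma rpow_nonneg (r s : R) : 0 <= rpow r s.
Proof.
  unfold rpow. destruct (Req_EM_T r 0); [lra |]. left. apply exp_pos.
Qed.

Definition cost (s : R) (l : list ((R * R -> Prop) * R)) : R :=
  lsum (fun c => rpow (snd c) s) l.

Lemma infinite_sum_of_bounded (u : nat -> R) (B : R) :
  (forall i, 0 <= u i) -> (forall n, sum_f_R0 u n <= B) ->
  exists l, infinite_sum u l /\ l <= B.
Proof.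
  intros hu hB.
  destruct (Un_cv_crit (sum_f_R0 u)) as [l hl].
  - intros n. simpl. specialize (hu (S n)). lra.
  - exists B. intros z [n ->]. apply hB.
  - exists l. split; [exact hl |].
    apply Rnot_lt_le. intros hlt.
    destruct (hl (l - B)) as [N hN]; [lra |].
    specialize (hN N (Nat.le_refl N)). specialize (hB N).
    unfold Rdist in hN. apply Rabs_def2 in hN. lra.
Qed.

Lemma nth_lsum {T : Type} (f : T -> R) (d : T) (l : list T) (n : nat) :
  (n <= length l)%nat -> (forall x, 0 <= f x) ->
  lsum (fun i => f (nth i l d)) (seq 0 n) <= lsum f l.
Proof.
  intros hn hf. revert n hn. induction l as [| x l IH]; intros n hn.
  - simpl in hn. replace n with 0%nat by lia. unfold lsum. simpl. lra.
  - destruct n as [| n].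
    + change (0 <= lsum f (x :: l)). apply lsum_nonneg. auto.
    + simpl seq. rewrite !lsum_cons, <- seq_shift, lsum_map. simpl nth.
      simpl in hn. specialize (IH n ltac:(lia)). lra.
Qed.

(* The lists are enumerated through the increasing chain of their concatenations. *)
Lemma Hs_delta_null_of_lists (s delta C q : R) (E : R * R -> Prop)
  (l : nat -> list ((R * R -> Prop) * R)) (N0 : nat) :
  0 <= delta -> 0 <= q < 1 -> 0 <= C ->
  (forall n, cost s (l n) <= C * q ^ n) ->
  (forall n c, (N0 <= n)%nat -> In c (l n) -> 0 <= snd c <= delta /\ diam_le (fst c) (snd c)) ->
  (forall p, E p -> forall N, exists n c, (N <= n)%nat /\ In c (l n) /\ fst c p) ->
  Hs_delta_null s delta E.
Proof.
  intros hdelta hq hC hcost hdiam hE eps heps.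
  pose (dflt := ((fun _ : R * R => False), 0)).
  assert (hsmall : exists N1 : nat, (N0 <= N1)%nat /\ C * q ^ N1 / (1 - q) < eps).
  { destruct (pow_lt_1_zero q) with (y := eps * (1 - q) / (C + 1)) as [N hN].
    - rewrite Rabs_right; lra.
    - apply Rmult_lt_0_compat; [nra | apply Rinv_0_lt_compat; lra].
    - exists (N + N0)%nat. split; [lia |].
      specialize (hN (N + N0)%nat ltac:(lia)).
      assert (0 <= q ^ (N + N0)) by (apply pow_le; lra).
      rewrite Rabs_right in hN by lra.
      apply Rmult_lt_reg_r with (1 - q); [lra |].
      replace (C * q ^ (N + N0) / (1 - q) * (1 - q)) with (C * q ^ (N + N0)) by (field; lra).
      apply Rmult_lt_compat_r with (r := C + 1) in hN; [| lra].
      replace (eps * (1 - q) / (C + 1) * (C + 1)) with (eps * (1 - q)) in hN by (field; lra).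
      nra. }
  destruct hsmall as [N1 [hN1 hN1s]].
  (* Dropping the first [N1] lists leaves a tail of cost below [eps], and it still covers [E]
     because each point lies in lists of arbitrarily large index. The empty set [dflt], of radius
     and cost 0, heads every list so that [W (S k)] has more than [k] entries and [u k] is one of
     them. *)
  pose (l' := fun n => dflt :: l (N1 + n)%nat).
  pose (W := fun n => flat_map l' (seq 0 n)).
  assert (hWS : forall n, W (S n) = W n ++ l' n).
  { intros n. unfold W. rewrite seq_S, flat_map_app. simpl. rewrite app_nil_r. reflexivity. }
  assert (hWlen : forall n, (n <= length (W n))%nat).
  { induction n as [| n IH]; [lia |]. rewrite hWS, length_app. simpl. lia. }
  assert (hpre : forall n m, (n <= m)%nat -> exists w, W m = W n ++ w).
  { intros n m h. induction h as [| m h [w IH]]; [exists nil; symmetry; apply app_nil_r |].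
    exists (w ++ l' m). rewrite hWS, IH, app_assoc. reflexivity. }
  pose (u := fun k => nth k (W (S k)) dflt).
  assert (hu : forall k n, (k < length (W n))%nat -> u k = nth k (W n) dflt).
  { intros k n hk. unfold u. destruct (Nat.le_ge_cases (S k) n) as [h | h].
    - destruct (hpre _ _ h) as [w ->]. rewrite app_nth1; [reflexivity |].
      specialize (hWlen (S k)). lia.
    - destruct (hpre _ _ h) as [w ->]. rewrite app_nth1; [reflexivity | exact hk]. }
  assert (hWc : forall n, cost s (W n) <= C * q ^ N1 / (1 - q)).
  { intros n. eapply Rle_trans; [| apply (lsum_geom C q N1 n hq hC)].
    unfold cost, W. rewrite lsum_flat_map. apply lsum_le. intros i _.
    unfold l'. rewrite lsum_cons. specialize (hcost (N1 + i)%nat). unfold cost in hcost.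
    simpl snd. unfold rpow at 1. destruct (Req_EM_T 0 0); [lra | congruence]. }
  destruct (infinite_sum_of_bounded (fun k => rpow (snd (u k)) s) (C * q ^ N1 / (1 - q)))
    as [tot [htot1 htot2]].
  - intros i. apply rpow_nonneg.
  - intros n. rewrite sum_f_R0_lsum. eapply Rle_trans; [| apply (hWc (S n))].
    unfold cost. eapply Rle_trans; [| apply (nth_lsum _ dflt _ (S n))].
    + apply lsum_le. intros i hi. apply in_seq in hi. rewrite (hu i (S n)); [lra |].
      specialize (hWlen (S n)). lia.
    + apply hWlen.
    + intros c. apply rpow_nonneg.
  - exists (fun k => fst (u k)), (fun k => snd (u k)), tot.
    split; [| split; [| split; [exact htot1 | lra]]].
    + intros p hp. destruct (hE p hp N1) as [n [c [hn [hc hcp]]]].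
      assert (hin : In c (W (S (n - N1)))).
      { rewrite hWS. apply in_or_app. right. right.
        replace (N1 + (n - N1))%nat with n by lia. exact hc. }
      destruct (In_nth _ _ dflt hin) as [k [hk1 hk2]].
      exists k. rewrite (hu k _ hk1), hk2. exact hcp.
    + intros n. assert (hin : In (u n) (W (S n))).
      { apply nth_In. specialize (hWlen (S n)). lia. }
      unfold W in hin. apply in_flat_map in hin. destruct hin as [i [_ [hi | hi]]].
      * rewrite <- hi. simpl. split; [lra |]. intros p r [].
      * eapply hdiam; [| exact hi]. lia.
Qed.

Lemma dist2_le (p q : R * R) (u v : R) :
  Rabs (fst p - fst q) <= u -> Rabs (snd p - snd q) <= v -> dist2 p q <= u + v.
Proof.
  intros hu hv. unfold dist2.
  pose proof (Rabs_pos (fst p - fst q)). pose proof (Rabs_pos (snd p - snd q)).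
  apply Rle_trans with (sqrt ((u + v) ^ 2)).
  - apply sqrt_le_1_alt. rewrite <- (pow2_abs (fst p - fst q)), <- (pow2_abs (snd p - snd q)).
    nra.
  - rewrite sqrt_pow2; lra.
Qed.

Lemma rpow_exp (x s y : R) : 0 < x -> rpow (x * exp y) s = exp (s * ln x) * exp (s * y).
Proof.
  intros hx. pose proof (exp_pos y). unfold rpow.
  destruct (Req_EM_T (x * exp y) 0) as [h | h]; [nra |].
  unfold Rpower. rewrite ln_mult, ln_exp by lra. rewrite <- exp_plus. f_equal. ring.
Qed.

(** Both coordinates are covered at the same [rho], so the products are squares up to the constants
    [INR a] and [INR b], and their diameter is at most the sum of the sides. The 625 is 25 * 25. *)
Lemma near_cover_square (a b : nat) (La Lb : list nat) (Ca Cb : R -> Prop) (xo yo : R)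
  (n : nat) (s s' rho sg : R) :
  (2 <= a)%nat -> (2 <= b)%nat -> digit_set a La -> digit_set b Lb ->
  is_attractor a La Ca -> is_attractor b Lb Cb -> Ca xo -> Cb yo ->
  0 <= s -> 0 <= s' -> ln (INR a) + s <= rho -> ln (INR b) + s' <= rho ->
  exists l : list ((R * R -> Prop) * R),
    cost sg l <= 625 * INR (length La) * INR (length Lb)
      * exp (sg * ln (INR a + INR b))
      * exp (INR n * (ln (INR (length La)) / ln (INR a) * (rho - s)
                      + ln (INR (length Lb)) / ln (INR b) * (rho - s') - rho * sg)) /\
    (forall c, In c l -> snd c = (INR a + INR b) * exp (- (INR n * rho))
                         /\ diam_le (fst c) (snd c)) /\
    forall p, Ca (fst p) -> Cb (snd p) ->
      dnint (INR a ^ n * fst p - xo) <= exp (- (INR n * s)) ->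
      dnint (INR b ^ n * snd p - yo) <= exp (- (INR n * s')) ->
      exists c, In c l /\ fst c p.
Proof.
  intros ha hb [_ [hLa hLa2]] [_ [hLb hLb2]] hCa hCb hxo hyo hs hs' hr hr'.
  pose proof (INR_gt_1 a ha) as ha1. pose proof (INR_gt_1 b hb) as hb1.
  destruct (near_cover_rate a La Ca xo n s rho) as [l [hl1 hl2]]; auto; [lia |].
  destruct (near_cover_rate b Lb Cb yo n s' rho) as [l' [hl1' hl2']]; auto; [lia |].
  set (e := exp (- (INR n * rho))) in *.
  assert (he : 0 < e) by apply exp_pos.
  exists (map (fun c => ((fun p : R * R => fst c <= fst p <= fst c + INR a * e /\
                               snd c <= snd p <= snd c + INR b * e),
                    (INR a + INR b) * e)) (list_prod l l')).
  split; [| split].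
  - unfold cost. rewrite lsum_map. simpl snd. rewrite lsum_const, length_prod, mult_INR.
    unfold e. rewrite rpow_exp by lra.
    pose proof (exp_pos (sg * ln (INR a + INR b))) as h1.
    pose proof (exp_pos (sg * - (INR n * rho))) as h2.
    set (E1 := exp (sg * ln (INR a + INR b))) in *.
    replace (INR n * (ln (INR (length La)) / ln (INR a) * (rho - s)
       + ln (INR (length Lb)) / ln (INR b) * (rho - s') - rho * sg)) with
      (INR n * (ln (INR (length La)) / ln (INR a) * (rho - s)) +
       INR n * (ln (INR (length Lb)) / ln (INR b) * (rho - s')) + sg * - (INR n * rho)) by ring.
    rewrite !exp_plus. set (E2 := exp (sg * - (INR n * rho))) in *.
    set (E3 := exp (INR n * (ln (INR (length La)) / ln (INR a) * (rho - s)))) in *.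
    set (E4 := exp (INR n * (ln (INR (length Lb)) / ln (INR b) * (rho - s')))) in *.
    replace (625 * INR (length La) * INR (length Lb) * E1 * (E3 * E4 * E2)) with
      ((25 * INR (length La) * E3) * (25 * INR (length Lb) * E4) * (E1 * E2)) by ring.
    apply Rmult_le_compat_r; [nra |].
    apply Rmult_le_compat; auto using pos_INR.
  - intros c hc. apply in_map_iff in hc. destruct hc as [z [<- _]]. simpl.
    split; [reflexivity |]. intros p r [hp1 hp2] [hr1 hr2].
    rewrite Rmult_plus_distr_r. apply dist2_le; apply Rabs_le; lra.
  - intros p hp1 hp2 hd1 hd2.
    destruct (hl2 _ hp1 hd1) as [c [hc hcp]]. destruct (hl2' _ hp2 hd2) as [c' [hc' hcp']].
    eexists. split; [apply in_map, in_prod; eassumption |]. simpl. auto.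
Qed.

(** Let [j] be the last grid index at which the bound on [u] holds. Failure at the next index bounds
    [u] from below, and the product then bounds [v] with the loss of one grid step [tau / J]. The
    [Rmax 0] keeps the bound meaningful when only v <= 1 is known. *)
Lemma product_split (u v tau : R) (J : nat) :
  (1 <= J)%nat -> 0 <= u <= 1 -> 0 <= v <= 1 -> 0 <= tau -> u * v < exp (- tau) ->
  exists j : nat, (j <= J)%nat /\ u <= exp (- (INR j * tau / INR J)) /\
    v <= exp (- Rmax 0 (tau - INR j * tau / INR J - tau / INR J)).
Proof.
  intros hJ hu hv ht huv.
  assert (hJ0 : 0 < INR J) by (apply lt_0_INR; lia).
  assert (H : forall i : nat, u <= exp (- (INR i * tau / INR J)) \/
     exists j : nat, (j < i)%nat /\ u <= exp (- (INR j * tau / INR J)) /\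
       exp (- (INR (S j) * tau / INR J)) < u).
  { induction i as [| i IH].
    - left. replace (- (INR 0 * tau / INR J)) with 0 by (simpl; field; lra). rewrite exp_0. lra.
    - destruct IH as [IH | [j [h1 h2]]]; [| right; exists j; split; [lia | exact h2]].
      destruct (Rle_lt_dec u (exp (- (INR (S i) * tau / INR J)))) as [h | h]; [left; exact h |].
      right. exists i. split; [lia | split; assumption]. }
  destruct (H J) as [h | [j [h1 [h2 h3]]]].
  - exists J. split; [lia | split; [exact h |]].
    rewrite Rmax_left; [rewrite Ropp_0, exp_0; lra |].
    replace (INR J * tau / INR J) with tau by (field; lra).
    assert (0 <= tau / INR J) by (apply Rmult_le_pos; [lra | left; apply Rinv_0_lt_compat; lra]).
    lra.
  - exists j. split; [lia | split; [exact h2 |]].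
    unfold Rmax. destruct (Rle_dec 0 _) as [h | h]; [| rewrite Ropp_0, exp_0; lra].
    apply Rnot_lt_le. intros hlt. apply (Rlt_irrefl (exp (- tau))).
    eapply Rle_lt_trans; [| exact huv].
    replace (- tau) with (- (INR (S j) * tau / INR J) +
      - (tau - INR j * tau / INR J - tau / INR J)) by (rewrite S_INR; field; lra).
    rewrite exp_plus. apply Rmult_le_compat; try (left; apply exp_pos); lra.
Qed.

Lemma Hs_null_Mc (a b : nat) (La Lb : list nat) (Ca Cb : R -> Prop) (xo yo t F sg : R) :
  (2 <= a)%nat -> (2 <= b)%nat -> digit_set a La -> digit_set b Lb ->
  is_attractor a La Ca -> is_attractor b Lb Cb -> Ca xo -> Cb yo -> 0 < t ->
  (forall s, 0 <= s <= t ->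
     let rho := Rmax (ln (INR a) + s) (ln (INR b) + t - s) in
     ln (INR (length La)) / ln (INR a) * (rho - s)
     + ln (INR (length Lb)) / ln (INR b) * (rho - t + s) <= F * rho) ->
  F < sg -> Hs_null sg (Mc a b Ca Cb xo yo t).
Proof.
  intros ha hb hLa hLb hCa hCb hxo hyo ht hF hsg delta hdelta.
  pose proof (INR_gt_1 a ha) as ha1. pose proof (INR_gt_1 b hb) as hb1.
  pose proof (ln_pos _ ha1) as hal. pose proof (ln_pos _ hb1) as hbl.
  set (al := ln (INR a)) in *. set (be := ln (INR b)) in *.
  set (d1 := ln (INR (length La)) / al) in *. set (d2 := ln (INR (length Lb)) / be) in *.
  assert (hA : 2 <= INR (length La)) by (destruct hLa as [_ [_ h]]; apply le_INR in h; exact h).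
  assert (hB : 2 <= INR (length Lb)) by (destruct hLb as [_ [_ h]]; apply le_INR in h; exact h).
  assert (hd2 : 0 < d2).
  { apply Rmult_lt_0_compat; [apply ln_pos; lra | apply Rinv_0_lt_compat; lra]. }
  (* At scale [rho] the cost exponent has the margin (sg - F) rho >= 2 eta, as rho >= al. One [eta]
     pays for the grid step, through [d2 * (t / J)], and the other leaves the geometric decay e^(-n
     eta). *)
  set (eta := (sg - F) * al / 2).
  assert (heta : 0 < eta) by (unfold eta; nra).
  assert (hJ : exists J : nat, (1 <= J)%nat /\ d2 * (t / INR J) <= eta).
  { destruct (nat_floor (d2 * t / eta)) as [J hJ].
    { apply Rmult_le_pos; [nra | left; apply Rinv_0_lt_compat; lra]. }
    exists (S J). split; [lia |]. rewrite S_INR. pose proof (pos_INR J).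
    apply Rmult_le_reg_r with (INR J + 1); [lra |].
    replace (d2 * (t / (INR J + 1)) * (INR J + 1)) with (d2 * t / eta * eta) by (field; lra).
    rewrite (Rmult_comm eta). apply Rmult_le_compat_r; lra. }
  destruct hJ as [J [hJ1 hJ]].
  assert (hJ0 : 0 < INR J) by (apply lt_0_INR; lia).
  assert (htJ : 0 <= t / INR J) by (apply Rmult_le_pos; [lra | left; apply Rinv_0_lt_compat; lra]).
  set (sj := fun j : nat => INR j * t / INR J).
  set (sj' := fun j : nat => Rmax 0 (t - sj j - t / INR J)).
  set (rj := fun j => Rmax (al + sj j) (be + t - sj j)).
  assert (hsj : forall j, (j <= J)%nat -> 0 <= sj j <= t).
  { intros j hj. apply le_INR in hj. pose proof (pos_INR j). unfold sj. split.
    - apply Rmult_le_pos; [nra | left; apply Rinv_0_lt_compat; lra].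
    - apply Rmult_le_reg_r with (INR J); [lra |].
      replace (INR j * t / INR J * INR J) with (INR j * t) by (field; lra). nra. }
  assert (hr1 : forall j, al + sj j <= rj j) by (intros; apply Rmax_l).
  assert (hr2 : forall j, be + t - sj j <= rj j) by (intros; apply Rmax_r).
  set (Cst := 625 * INR (length La) * INR (length Lb) * exp (sg * ln (INR a + INR b))).
  assert (hC : 0 <= Cst).
  { unfold Cst. pose proof (exp_pos (sg * ln (INR a + INR b))).
    apply Rmult_le_pos; [nra | lra]. }
  assert (Hl : forall nj : nat * nat, exists l : list ((R * R -> Prop) * R),
    (snd nj <= J)%nat ->
    cost sg l <= Cst * exp (- eta) ^ (fst nj) /\
    (forall c, In c l -> snd c = (INR a + INR b) * exp (- (INR (fst nj) * rj (snd nj)))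
                         /\ diam_le (fst c) (snd c)) /\
    forall p, Ca (fst p) -> Cb (snd p) ->
      dnint (INR a ^ (fst nj) * fst p - xo) <= exp (- (INR (fst nj) * sj (snd nj))) ->
      dnint (INR b ^ (fst nj) * snd p - yo) <= exp (- (INR (fst nj) * sj' (snd nj))) ->
      exists c, In c l /\ fst c p).
  { intros [n j]. simpl fst. simpl snd.
    destruct (le_lt_dec j J) as [hj | hj]; [| exists nil; intros; lia].
    pose proof (hsj j hj) as hs.
    assert (hs'0 : 0 <= sj' j) by apply Rmax_l.
    assert (hs' : t - sj j - t / INR J <= sj' j) by apply Rmax_r.
    destruct (near_cover_square a b La Lb Ca Cb xo yo n (sj j) (sj' j) (rj j) sg)
      as [l [hl1 [hl2 hl3]]]; auto; try lra.
    { eapply Rle_trans; [| apply hr2]. unfold sj'. fold be.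
      unfold Rmax. destruct (Rle_dec 0 _); lra. }
    exists l. intros _. split; [| split; assumption].
    eapply Rle_trans; [exact hl1 |]. fold al be d1 d2 Cst.
    apply Rmult_le_compat_l; [exact hC |].
    rewrite (pow_exp_ln (exp (- eta))), ln_exp by apply exp_pos. apply exp_le.
    apply Rmult_le_compat_l; [apply pos_INR |].
    specialize (hF (sj j) hs). cbv zeta in hF. fold (rj j) in hF.
    assert (h1 : d2 * (rj j - sj' j) <= d2 * (rj j - t + sj j) + d2 * (t / INR J)) by nra.
    assert (h2 : (sg - F) * al <= (sg - F) * rj j).
    { apply Rmult_le_compat_l; [lra |]. specialize (hr1 j). lra. }
    unfold eta in *. lra. }
  destruct (fun_choice _ Hl) as [pk hpick].
  set (pick := fun n j => pk (n, j)).
  specialize (fun n j => hpick (n, j)) as hpick'. simpl fst in hpick'. simpl snd in hpick'.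
  destruct (pow_lt_1_zero (/ INR a)) with (y := delta / (INR a + INR b)) as [N0 hN0].
  { rewrite Rabs_right; [| apply Rle_ge; left; apply Rinv_0_lt_compat; lra].
    rewrite <- Rinv_1. apply Rinv_lt_contravar; lra. }
  { apply Rmult_lt_0_compat; [lra | apply Rinv_0_lt_compat; lra]. }
  apply (Hs_delta_null_of_lists sg delta (INR (S J) * Cst) (exp (- eta)) _
           (fun n => flat_map (pick n) (seq 0 (S J))) N0).
  - lra.
  - split; [left; apply exp_pos |]. rewrite <- exp_0. apply exp_increasing. lra.
  - apply Rmult_le_pos; [apply pos_INR | exact hC].
  - intros n. unfold cost. rewrite lsum_flat_map.
    rewrite <- (length_seq (S J) 0) at 2. rewrite Rmult_assoc, <- lsum_const.
    apply lsum_le. intros j hj. apply in_seq in hj.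
    destruct (hpick' n j) as [h _]; [lia | exact h].
  - intros n c hn hc. apply in_flat_map in hc. destruct hc as [j [hj hc]].
    apply in_seq in hj.
    destruct (hpick' n j) as [_ [h _]]; [lia |]. destruct (h c hc) as [h1 h2].
    split; [| exact h2]. rewrite h1. clear h1 h2 h hc.
    pose proof (exp_pos (- (INR n * rj j))). split; [nra |].
    specialize (hN0 n ltac:(lia)).
    assert (hxa : exp (- (INR n * rj j)) <= delta / (INR a + INR b)).
    { left. eapply Rle_lt_trans; [| exact hN0]. eapply Rle_trans; [| apply Rle_abs].
      rewrite pow_inv, inv_pow_exp_ln by lra. apply exp_le. fold al.
      specialize (hr1 j). pose proof (hsj j ltac:(lia)). pose proof (pos_INR n). nra. }
    replace delta with ((INR a + INR b) * (delta / (INR a + INR b))) by (field; lra).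
    apply Rmult_le_compat_l; lra.
  - intros p [hp1 [hp2 hp3]] N. destruct (hp3 N) as [n [hn hnp]].
    destruct (product_split (dnint (INR a ^ n * fst p - xo)) (dnint (INR b ^ n * snd p - yo))
                (INR n * t) J) as [j [hj [hj1 hj2]]]; auto.
    { split; [apply dnint_nonneg | apply dnint_le_1]. }
    { split; [apply dnint_nonneg | apply dnint_le_1]. }
    { pose proof (pos_INR n). nra. }
    destruct (hpick' n j hj) as [_ [_ h]].
    destruct (h p hp1 hp2) as [c [hc hcp]].
    { replace (INR n * sj j) with (INR j * (INR n * t) / INR J)
        by (unfold sj; field; lra). exact hj1. }
    { replace (INR n * sj' j) with
        (Rmax 0 (INR n * t - INR j * (INR n * t) / INR J - INR n * t / INR J)); [exact hj2 |].
      unfold sj', sj. rewrite <- RmaxRmult by apply pos_INR. f_equal; field; lra. }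
    exists n, c. split; [exact hn | split; [| exact hcp]].
    apply in_flat_map. exists j. split; [apply in_seq; lia | exact hc].
Qed.

(** * Mass on a tree of digits *)

(* A substitute for the mass distribution principle: [m k i x] is the mass that
   the [k]-th set takes in the node [x] of level [i], relative to the mass of the
   node. Some child always keeps every partial sum over [k] below [theta]. *)
Lemma greedy_path {T : Type} (ch : nat -> T -> list T) (m : nat -> nat -> T -> R)
  (theta : R) (root : T) :
  (forall i x, ch i x <> nil) -> (forall k i x, 0 <= m k i x) ->
  (forall k i x, lsum (m k (S i)) (ch i x) <= INR (length (ch i x)) * m k i x) ->
  (forall n, lsum (fun k => m k 0%nat root) (seq 0 n) <= theta) ->
  exists path : nat -> T, path 0%nat = root /\ (forall i, In (path (S i)) (ch i (path i))) /\
    forall i k, m k i (path i) <= theta.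
Proof.
  intros hch hm hsup hroot.
  pose (good := fun i x => forall n, lsum (fun k => m k i x) (seq 0 n) <= theta).
  assert (step : forall i x, good i x -> exists y, In y (ch i x) /\ good (S i) y).
  { intros i x hx. apply NNPP. intros hno.
    (* If every child violated the bound, there would be one [n] for which all their partial sums
       exceed [theta], finitely many children being involved. Yet the mean of these sums over the
       children is at most that of the parent. *)
    assert (hbad : forall l, incl l (ch i x) -> exists n, forall y, In y l ->
      theta < lsum (fun k => m k (S i) y) (seq 0 n)).
    { induction l as [| y l IH]; intros hl; [exists 0%nat; intros y [] |].
      destruct IH as [n hn]. { intros z hz. apply hl. right. exact hz. }
      assert (hy : exists n, theta < lsum (fun k => m k (S i) y) (seq 0 n)).
      { apply NNPP. intros h. apply hno. exists y. split; [apply hl; left; reflexivity |].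
        intros n'. apply Rnot_lt_le. intros h'. apply h. exists n'. exact h'. }
      destruct hy as [n' hn']. exists (Nat.max n n'). intros z hz.
      eapply Rlt_le_trans; [| apply (lsum_seq_mono _ (if excluded_middle_informative (z = y)
        then n' else n)); [intros; apply hm | destruct excluded_middle_informative; lia]].
      destruct excluded_middle_informative as [-> | hne]; [exact hn' |].
      destruct hz as [hz | hz]; [congruence | apply hn, hz]. }
    destruct (hbad (ch i x) (incl_refl _)) as [n hn].
    assert (h1 : INR (length (ch i x)) * theta <
                 lsum (fun y => lsum (fun k => m k (S i) y) (seq 0 n)) (ch i x)).
    { specialize (hch i x). rewrite <- lsum_const.
      destruct (ch i x) as [| y l]; [congruence |]. rewrite !lsum_cons.
      assert (theta < lsum (fun k => m k (S i) y) (seq 0 n)) by (apply hn; left; reflexivity).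
      assert (lsum (fun _ => theta) l <=
              lsum (fun y => lsum (fun k => m k (S i) y) (seq 0 n)) l); [| lra].
      apply lsum_le. intros z hz. left. apply hn. right. exact hz. }
    rewrite lsum_exchange in h1.
    assert (h2 : lsum (fun k => lsum (fun y => m k (S i) y) (ch i x)) (seq 0 n) <=
                 INR (length (ch i x)) * theta).
    { apply Rle_trans with (lsum (fun k => INR (length (ch i x)) * m k i x) (seq 0 n)).
      - apply lsum_le. intros k _. apply hsup.
      - rewrite lsum_scal. apply Rmult_le_compat_l; [apply pos_INR | apply hx]. }
    lra. }
  pose (St := {p : nat * T | good (fst p) (snd p)}).
  assert (step' : forall p : St, exists q : St,
     fst (proj1_sig q) = S (fst (proj1_sig p)) /\
     In (snd (proj1_sig q)) (ch (fst (proj1_sig p)) (snd (proj1_sig p)))).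
  { intros [[i x] hx]. destruct (step i x hx) as [y [hy1 hy2]].
    exists (exist _ (S i, y) hy2). simpl. auto. }
  destruct (fun_choice _ step') as [nxt hnxt].
  pose (p0 := exist (fun p : nat * T => good (fst p) (snd p)) (0%nat, root) hroot : St).
  pose (orb := fun n => Nat.iter n nxt p0).
  assert (hlev : forall n, fst (proj1_sig (orb n)) = n).
  { induction n as [| n IH]; [reflexivity |].
    change (orb (S n)) with (nxt (orb n)). rewrite (proj1 (hnxt _)), IH. reflexivity. }
  exists (fun n => snd (proj1_sig (orb n))). split; [reflexivity | split].
  - intros i. pose proof (proj2 (hnxt (orb i))) as h. rewrite (hlev i) in h. exact h.
  - intros i k. pose proof (proj2_sig (orb i)) as h. cbv beta in h. rewrite (hlev i) in h.
    eapply Rle_trans; [| apply (h (S k))].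
    rewrite seq_S, lsum_app, lsum_cons. simpl.
    assert (0 <= lsum (fun k => m k i (snd (proj1_sig (orb i)))) (seq 0 k))
      by (apply lsum_nonneg; auto).
    unfold lsum at 2. simpl. lra.
Qed.

(** * Averages over the descendants of a cell *)

Definition indic (P : Prop) : R := if excluded_middle_informative P then 1 else 0.

Lemma indic_true (P : Prop) : P -> indic P = 1.
Proof. intros h. unfold indic. destruct excluded_middle_informative; tauto. Qed.

Lemma indic_false (P : Prop) : ~ P -> indic P = 0.
Proof. intros h. unfold indic. destruct excluded_middle_informative; tauto. Qed.

Lemma indic_bounds (P : Prop) : 0 <= indic P <= 1.
Proof. unfold indic. destruct excluded_middle_informative; lra. Qed.

Lemma indic_le (P Q : Prop) : (P -> Q) -> indic P <= indic Q.
Proof. intros h. unfold indic. repeat destruct excluded_middle_informative; tauto || lra. Qed.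

(* [X] at level [i] encodes the cell [X/a^i, (X+1)/a^i], whose children are given by
   the digits in [D i]; [avg] is the mean of [h] over the descendants [j] levels
   below. *)
Fixpoint avg (a : nat) (D : nat -> list nat) (h : nat -> R) (j i X : nat) : R :=
  match j with
  | O => h X
  | S j => / INR (length (D i)) * lsum (fun k => avg a D h j (S i) (a * X + k)) (D i)
  end.

(** The share of the mass of a cell of level [i] that the uniform distribution gives to each
    descendant [j] levels below. *)
Fixpoint weight (D : nat -> list nat) (i j : nat) : R :=
  match j with
  | O => 1
  | S j => / INR (length (D i)) * weight D (S i) j
  end.

Definition digit_tree (a : nat) (D : nat -> list nat) : Prop :=
  forall i, D i <> nil /\ NoDup (D i) /\ forall k, In k (D i) -> (k < a)%nat.

Lemma length_pos {T : Type} (l : list T) : l <> nil -> 0 < INR (length l).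
Proof. intros h. apply lt_0_INR. destruct l; [congruence | simpl; lia]. Qed.

Lemma avg_le (a : nat) (D : nat -> list nat) (h h' : nat -> R) (j i X : nat) :
  digit_tree a D -> (forall Y, h Y <= h' Y) -> avg a D h j i X <= avg a D h' j i X.
Proof.
  intros hD hh. revert i X. induction j as [| j IH]; intros i X; [apply hh |].
  simpl. apply Rmult_le_compat_l.
  - left. apply Rinv_0_lt_compat, length_pos, hD.
  - apply lsum_le. auto.
Qed.

Lemma avg_nonneg (a : nat) (D : nat -> list nat) (h : nat -> R) (j i X : nat) :
  digit_tree a D -> (forall Y, 0 <= h Y) -> 0 <= avg a D h j i X.
Proof.
  intros hD hh. revert i X. induction j as [| j IH]; intros i X; [apply hh |].
  simpl. apply Rmult_le_pos.
  - left. apply Rinv_0_lt_compat, length_pos, hD.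
  - apply lsum_nonneg. auto.
Qed.

Lemma avg_lsum {S : Type} (a : nat) (D : nat -> list nat) (g : S -> nat -> R) (l : list S)
  (j i X : nat) :
  avg a D (fun Y => lsum (fun z => g z Y) l) j i X = lsum (fun z => avg a D (g z) j i X) l.
Proof.
  revert i X. induction j as [| j IH]; intros i X; [reflexivity |].
  simpl. rewrite lsum_scal. f_equal. rewrite <- lsum_exchange.
  apply lsum_ext. auto.
Qed.

Lemma avg_add (a : nat) (D : nat -> list nat) (h : nat -> R) (j j' i X : nat) :
  avg a D h (j + j') i X = avg a D (avg a D h j' (i + j)) j i X.
Proof.
  revert i X. induction j as [| j IH]; intros i X; [rewrite Nat.add_0_r; reflexivity |].
  simpl. f_equal. apply lsum_ext. intros k _.
  rewrite IH, Nat.add_succ_r. reflexivity.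
Qed.

Lemma weight_nonneg (a : nat) (D : nat -> list nat) (i j : nat) :
  digit_tree a D -> 0 <= weight D i j.
Proof.
  intros hD. revert i. induction j as [| j IH]; intros i; simpl; [lra |].
  apply Rmult_le_pos; [| apply IH]. left. apply Rinv_0_lt_compat, length_pos, hD.
Qed.

(** Cells are closed, so that the limit of a branch meets all the cells of the branch even if it is
    an endpoint. *)
Definition meets (a : nat) (U : R -> Prop) (i X : nat) : Prop :=
  exists x, U x /\ INR X <= INR a ^ i * x <= INR X + 1.

Lemma avg_meets (a : nat) (D : nat -> list nat) (U : R -> Prop) (j i X : nat) :
  digit_tree a D ->
  avg a D (fun Y => indic (meets a U (i + j) Y)) j i X <= indic (meets a U i X).
Proof.
  intros hD. revert i X. induction j as [| j IH]; intros i X.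
  - simpl. rewrite Nat.add_0_r. lra.
  - simpl. destruct (hD i) as [h1 [_ h3]]. pose proof (length_pos _ h1) as hlen.
    apply Rmult_le_reg_l with (INR (length (D i))); [exact hlen |].
    rewrite <- Rmult_assoc, Rinv_r, Rmult_1_l by lra.
    rewrite <- lsum_const. apply lsum_le. intros k hk.
    replace (i + S j)%nat with (S i + j)%nat by lia.
    eapply Rle_trans; [apply IH |]. apply indic_le.
    intros [x [hx hxX]]. exists x. split; [exact hx |].
    specialize (h3 k hk). assert (ha : 0 < INR a) by (apply lt_0_INR; lia).
    apply le_INR in h3. rewrite S_INR in h3. pose proof (pos_INR k).
    rewrite plus_INR, mult_INR in hxX. simpl pow in hxX.
    split; apply Rmult_le_reg_l with (INR a); lra.
Qed.

(** The ancestor of cell [z] at [j] levels above is the quotient of [z] by a^j, and since digits do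
    not repeat each cell is reached by at most one descent. [z] is an integer because the neighbours
    of a cell may have negative index. *)
Lemma avg_point (a : nat) (D : nat -> list nat) (z : Z) (j i X : nat) :
  digit_tree a D ->
  avg a D (fun Y => indic (Z.of_nat Y = z)) j i X
    <= indic (Z.of_nat X = z / Z.of_nat a ^ Z.of_nat j)%Z * weight D i j.
Proof.
  intros hD. revert i X. induction j as [| j IH]; intros i X.
  - simpl. rewrite Z.div_1_r. lra.
  - simpl avg. simpl weight. destruct (hD i) as [h1 [h2 h3]].
    pose proof (length_pos _ h1) as hlen.
    rewrite (Rmult_comm (indic _)), Rmult_assoc.
    apply Rmult_le_compat_l; [left; apply Rinv_0_lt_compat; lra |].
    assert (ha : (0 < a)%nat).
    { destruct (D i) as [| k l]; [congruence |]. specialize (h3 k (or_introl eq_refl)). lia. }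
    set (Q := (z / Z.of_nat a ^ Z.of_nat j)%Z).
    assert (hQ : (z / Z.of_nat a ^ Z.of_nat (S j) = Q / Z.of_nat a)%Z).
    { unfold Q. rewrite Z.div_div by lia. f_equal.
      rewrite Nat2Z.inj_succ, Z.pow_succ_r by lia. lia. }
    rewrite hQ.
    pose proof (weight_nonneg a D (S i) j hD) as hw.
    apply Rle_trans with (lsum (fun k => weight D (S i) j * indic (Z.of_nat (a * X + k) = Q)) (D i)).
    { apply lsum_le. intros k _. rewrite Rmult_comm. apply IH. }
    rewrite lsum_scal. apply Rmult_le_compat_l; [exact hw |].
    clear - h2 h3 ha. induction (D i) as [| k l IHl].
    + unfold lsum. simpl. apply indic_bounds.
    + rewrite lsum_cons. apply NoDup_cons_iff in h2. destruct h2 as [h2 h2'].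
      destruct (excluded_middle_informative (Z.of_nat (a * X + k) = Q)) as [hk | hk].
      * rewrite indic_true by exact hk.
        assert (hk' : (k < a)%nat) by (apply h3; left; reflexivity).
        rewrite indic_true by (apply (Z.div_unique _ _ _ (Z.of_nat k)); lia).
        replace (lsum (fun k => indic (Z.of_nat (a * X + k) = Q)) l) with 0; [lra |].
        rewrite <- (Rmult_0_r (INR (length l))), <- lsum_const.
        apply lsum_ext. intros k' hk2. symmetry. apply indic_false.
        intros h. apply h2. replace k with k' by lia. exact hk2.
      * rewrite indic_false by exact hk. rewrite Rplus_0_l. apply IHl; [exact h2' |].
        intros k' hk'. apply h3. right. exact hk'.
Qed.

(* A set of diameter at most [a^-m] meets at most four cells of level [m]. *)
Lemma avg_meets_small (a : nat) (D : nat -> list nat) (U : R -> Prop) (m N : nat) :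
  (2 <= a)%nat -> digit_tree a D -> (m <= N)%nat ->
  (forall x y, U x -> U y -> Rabs (x - y) <= / INR a ^ m) ->
  avg a D (fun Y => indic (meets a U N Y)) N 0 0 <= 4 * weight D 0 m.
Proof.
  intros ha hD hmN hU. pose proof (INR_gt_1 a ha) as ha1.
  pose proof (weight_nonneg a D 0 m hD) as hw.
  assert (hpm : 0 < INR a ^ m) by (apply pow_lt; lra).
  replace N with (m + (N - m))%nat by lia. rewrite avg_add.
  eapply Rle_trans.
  { apply avg_le with (h' := fun Y => indic (meets a U m Y)); [exact hD |].
    intros Y. exact (avg_meets a D U (N - m) m Y hD). }
  destruct (excluded_middle_informative (exists x, U x)) as [[x0 hx0] | hno].
  - set (f := Int_part (INR a ^ m * x0)).
    set (l := (f - 2 :: f - 1 :: f :: f + 1 :: nil)%Z).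
    eapply Rle_trans.
    { apply avg_le with (h' := fun Y => lsum (fun z => indic (Z.of_nat Y = z)) l); [exact hD |].
      intros Y. destruct (excluded_middle_informative (meets a U m Y)) as [h | h].
      - rewrite indic_true by exact h. destruct h as [x [hx hxY]].
        specialize (hU x x0 hx hx0). apply Rabs_le_bounds in hU.
        destruct (base_Int_part (INR a ^ m * x0)) as [f1 f2]. fold f in f1, f2.
        assert (hd : -1 <= INR a ^ m * (x - x0) <= 1).
        { assert (h1 : INR a ^ m * / INR a ^ m = 1) by (apply Rinv_r; lra). split; nra. }
        assert (hz : (f - 3 < Z.of_nat Y < f + 2)%Z).
        { split; apply lt_IZR; [rewrite minus_IZR | rewrite plus_IZR];
            rewrite <- INR_IZR_INZ; lra. }
        assert (hz' : (Z.of_nat Y = f - 2 \/ Z.of_nat Y = f - 1 \/ Z.of_nat Y = f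
                       \/ Z.of_nat Y = f + 1)%Z) by lia.
        unfold l. rewrite !lsum_cons. unfold lsum. simpl fold_right.
        pose proof (indic_bounds (Z.of_nat Y = f - 2)%Z).
        pose proof (indic_bounds (Z.of_nat Y = f - 1)%Z).
        pose proof (indic_bounds (Z.of_nat Y = f)%Z).
        pose proof (indic_bounds (Z.of_nat Y = f + 1)%Z).
        destruct hz' as [e | [e | [e | e]]]; pose proof (indic_true _ e); lra.
      - rewrite indic_false by exact h. apply lsum_nonneg. intros. apply indic_bounds. }
    rewrite avg_lsum. apply Rle_trans with (lsum (fun _ => weight D 0 m) l).
    + apply lsum_le. intros z _. eapply Rle_trans; [apply avg_point, hD |].
      pose proof (indic_bounds (Z.of_nat 0 = z / Z.of_nat a ^ Z.of_nat m)%Z). nra.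
    + rewrite lsum_const. unfold l. simpl. lra.
  - apply Rle_trans with 0; [| lra].
    apply Rle_trans with (avg a D (fun Y => lsum (fun z => indic (Z.of_nat Y = z)) nil) m 0 0).
    + apply avg_le; [exact hD |]. intros Y. rewrite indic_false; [unfold lsum; simpl; lra |].
      intros [x [hx _]]. apply hno. exists x. exact hx.
    + rewrite avg_lsum. unfold lsum. simpl. lra.
Qed.

(** * Digit trees with forced blocks *)

Definition block_digits (L : list nat) (o : nat -> option nat) (i : nat) : list nat :=
  match o i with Some e => e :: nil | None => L end.

Definition forced (o : nat -> option nat) (i : nat) : R :=
  match o i with Some _ => 1 | None => 0 end.

Lemma weight_block_digits (L : list nat) (o : nat -> option nat) (i j : nat) :
  (1 <= length L)%nat ->
  weight (block_digits L o) i j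
    = exp (- (ln (INR (length L)) * (INR j - lsum (forced o) (seq i j)))).
Proof.
  intros hL. assert (hA : 0 < INR (length L)) by (apply lt_0_INR; lia).
  revert i. induction j as [| j IH]; intros i.
  - unfold lsum. simpl. rewrite <- exp_0. f_equal. ring.
  - simpl weight. simpl seq. rewrite IH, lsum_cons, S_INR. unfold block_digits, forced at 2.
    destruct (o i) as [e |].
    + simpl. rewrite Rinv_1, Rmult_1_l. f_equal. ring.
    + rewrite <- (exp_ln (INR (length L))) at 1 by lra.
      rewrite <- exp_Ropp, <- exp_plus. f_equal. ring.
Qed.

Lemma horner_block (a : nat) (k e : nat -> nat) (n l : nat) :
  (forall r, (r < l)%nat -> k (n + r)%nat = e r) ->
  horner a k (n + l) = (horner a k n * a ^ l + horner a e l)%nat.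
Proof.
  induction l as [| l IH]; intros h; [simpl; rewrite Nat.add_0_r; lia |].
  rewrite Nat.add_succ_r. simpl. rewrite IH by (intros; apply h; lia).
  rewrite h by lia. lia.
Qed.

Lemma count_interval (p l m : nat) :
  lsum (fun i => indic (p <= i < p + l)%nat) (seq 0 m) = INR (Nat.min l (m - p)).
Proof.
  induction m as [| m IH].
  - unfold lsum. simpl. rewrite Nat.min_0_r. reflexivity.
  - rewrite seq_S, lsum_app, IH, lsum_cons, lsum_nil, Rplus_0_r.
    replace (0 + m)%nat with m by lia.
    destruct (excluded_middle_informative (p <= m < p + l)%nat) as [h | h].
    + rewrite indic_true by exact h. rewrite !Nat.min_r by lia.
      replace (S m - p)%nat with (S (m - p)) by lia. rewrite S_INR. lra.
    + rewrite indic_false by exact h.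
      destruct (le_lt_dec p m) as [hp | hp].
      * rewrite !Nat.min_l by lia. lra.
      * replace (S m - p)%nat with 0%nat by lia. replace (m - p)%nat with 0%nat by lia. lra.
Qed.

(** This controls the blocks before the current one: their total length is a fraction of order 1 /
    (M - 1) of the current position. *)
Lemma sum_powers_le (M K : nat) :
  (1 <= M)%nat ->
  (INR M - 1) * lsum (fun k => INR (M ^ S k)) (seq 0 K) <= INR (M ^ S K).
Proof.
  intros hM. assert (h1 : 1 <= INR M) by (apply le_INR in hM; exact hM).
  induction K as [| K IH].
  - unfold lsum. simpl. rewrite Rmult_0_r. apply pos_INR.
  - rewrite seq_S, lsum_app, Rmult_plus_distr_l, lsum_cons, lsum_nil.
    replace (0 + K)%nat with K by lia.
    replace (INR (M ^ S (S K))) with (INR M * INR (M ^ S K)) by (rewrite <- mult_INR; reflexivity).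
    lra.
Qed.

(* Block [k] is [M^(k+1), M^(k+1) + len k), and its digits copy [e]. *)
Definition blocks (M : nat) (len e : nat -> nat) (i : nat) : option nat :=
  option_map (fun k => e (i - M ^ S k)%nat)
    (find (fun k => (M ^ S k <=? i) && (i <? M ^ S k + len k))%bool (seq 0 (S i))).

Lemma pow_ge_index (M k : nat) : (2 <= M)%nat -> (k < M ^ k)%nat.
Proof. intros h. apply Nat.pow_gt_lin_r. lia. Qed.

Lemma blocks_inside (M : nat) (len e : nat -> nat) (k r : nat) :
  (2 <= M)%nat -> (forall k, (M ^ S k + len k <= M ^ S (S k))%nat) ->
  (r < len k)%nat -> blocks M len e (M ^ S k + r) = Some (e r).
Proof.
  intros hM hlen hr. unfold blocks.
  destruct (find _ _) as [k' |] eqn:hf.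
  - apply find_some in hf. destruct hf as [_ hf].
    apply andb_prop in hf. destruct hf as [h1 h2].
    apply Nat.leb_le in h1. apply Nat.ltb_lt in h2.
    assert (k' = k).
    { destruct (Nat.lt_trichotomy k' k) as [h | [h | h]]; [| exact h |].
      - assert (M ^ S (S k') <= M ^ S k)%nat by (apply Nat.pow_le_mono_r; lia).
        specialize (hlen k'). lia.
      - assert (M ^ S (S k) <= M ^ S k')%nat by (apply Nat.pow_le_mono_r; lia).
        specialize (hlen k). lia. }
    subst k'. simpl option_map. f_equal. f_equal. lia.
  (* The search range in [blocks] misses no block containing the position, because k < M^(k+1). *)
  - exfalso. assert (hin : In k (seq 0 (S (M ^ S k + r)))).
    { apply in_seq. pose proof (pow_ge_index M (S k) hM). lia. }
    pose proof (find_none _ _ hf k hin) as h. simpl in h.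
    apply Bool.andb_false_iff in h. destruct h as [h | h].
    + apply Nat.leb_gt in h. simpl in h. lia.
    + apply Nat.ltb_ge in h. simpl in h. lia.
Qed.

Lemma blocks_values (M : nat) (len e : nat -> nat) (i d : nat) :
  blocks M len e i = Some d -> exists j, d = e j.
Proof.
  unfold blocks. destruct (find _ _) as [k |]; simpl; intros h; [| discriminate].
  injection h as h. exists (i - M * M ^ k)%nat. auto.
Qed.

(** Only blocks of index at most [K] start before [m]. The older ones are counted in full, block [K]
    only as far as [m]. *)
Lemma forced_blocks_count (M : nat) (len e : nat -> nat) (K m : nat) :
  (2 <= M)%nat -> (m <= M ^ S (S K))%nat ->
  lsum (forced (blocks M len e)) (seq 0 m)
    <= lsum (fun k => INR (len k)) (seq 0 K) + INR (Nat.min (len K) (m - M ^ S K)).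
Proof.
  intros hM hm.
  apply Rle_trans with
    (lsum (fun i => lsum (fun k => indic (M ^ S k <= i < M ^ S k + len k)%nat) (seq 0 (S K)))
       (seq 0 m)).
  - apply lsum_le. intros i hi. apply in_seq in hi.
    unfold forced, blocks. destruct (find _ _) as [k |] eqn:hf.
    + apply find_some in hf. destruct hf as [_ hf].
      apply andb_prop in hf. destruct hf as [h1 h2].
      apply Nat.leb_le in h1. apply Nat.ltb_lt in h2. simpl option_map. cbv iota.
      assert (hk : (k < S K)%nat).
      { apply Nat.nle_gt. intros h.
        assert (M ^ S (S K) <= M ^ S k)%nat by (apply Nat.pow_le_mono_r; lia). lia. }
      assert (hin : In k (seq 0 (S K))) by (apply in_seq; lia).
      apply in_split in hin. destruct hin as [l1 [l2 ->]].
      rewrite lsum_app, lsum_cons, indic_true by (split; assumption).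
      set (g := fun k => indic (M ^ S k <= i < M ^ S k + len k)%nat).
      assert (0 <= lsum g l1) by (apply lsum_nonneg; intros; apply indic_bounds).
      assert (0 <= lsum g l2) by (apply lsum_nonneg; intros; apply indic_bounds). lra.
    + simpl option_map. cbv iota. apply lsum_nonneg. intros. apply indic_bounds.
  - rewrite lsum_exchange, seq_S, lsum_app, lsum_cons.
    replace (0 + K)%nat with K by lia. rewrite count_interval.
    rewrite lsum_nil, Rplus_0_r. apply Rplus_le_compat_r. apply lsum_le. intros k _. rewrite count_interval.
    apply le_INR. lia.
Qed.

(** One coordinate of the Cantor subset of [Mc]. In the weight bound, [rate] is minus the logarithm
    of the scale and M^(J+1) the start of the current block. The subtracted terms are two roundings
    (of [m] and of the block length), the older blocks, and the [Rmin]: the part of the current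
    block already passed. The lower bound on [M] makes each block end before the next one starts. *)
Lemma side_tree (a : nat) (L : list nat) (K : R -> Prop) (x0 s : R) (M : nat) :
  (2 <= a)%nat -> digit_set a L -> is_attractor a L K -> K x0 -> 0 <= s ->
  (2 <= M)%nat -> s + ln (INR a) <= (INR M - 1) * ln (INR a) ->
  exists D : nat -> list nat,
    digit_tree a D /\ (forall i, incl (D i) L) /\
    (forall k x, (forall i, In (k i) (D i)) ->
       (forall n, INR (horner a k n) <= INR a ^ n * x <= INR (horner a k n) + 1) ->
       forall j, dnint (INR a ^ (M ^ S j) * x - x0) < exp (- (INR (M ^ S j) * s))) /\
    forall J rate m,
      INR m * ln (INR a) <= rate < (INR m + 1) * ln (INR a) -> (m <= M ^ S (S J))%nat ->
      weight D 0 m <= exp (- (ln (INR (length L)) / ln (INR a) *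
        (rate - 2 * ln (INR a) - (s + ln (INR a)) * INR (M ^ S J) / (INR M - 1)
         - Rmin (INR (M ^ S J) * s) (Rmax 0 (rate - ln (INR a) * INR (M ^ S J)))))).
Proof.
  intros ha [hL1 [hL2 hL3]] hK hx0 hs hM hMs.
  pose proof (INR_gt_1 a ha) as ha1. pose proof (ln_pos _ ha1) as hal.
  set (al := ln (INR a)) in *.
  assert (hM1 : 2 <= INR M) by (apply le_INR in hM; exact hM).
  assert (hA : 2 <= INR (length L)) by (apply le_INR in hL3; exact hL3).
  assert (hP : forall k, 1 <= INR (M ^ k)).
  { intros k. pose proof (pow_ge_index M k hM) as h. apply le_INR in h.
    rewrite S_INR in h. pose proof (pos_INR k). lra. }
  destruct (attractor_address a L K x0 ha hL2 hK hx0) as [e [he1 he2]].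
  (* One position more than the rounded-down length: the strict inequality is the one required in
     [Mc]. *)
  assert (hlen : forall k, exists l : nat,
    INR (M ^ S k) * s < INR l * al <= INR (M ^ S k) * s + al).
  { intros k. destruct (pow_floor a (INR (M ^ S k) * s) ha) as [q hq].
    { specialize (hP (S k)). nra. }
    exists (S q). rewrite S_INR. fold al in hq. lra. }
  destruct (fun_choice _ hlen) as [len hlen']. clear hlen.
  assert (hlenM : forall k, INR (len k) * al <= (s + al) * INR (M ^ S k)).
  { intros k. specialize (hlen' k). specialize (hP (S k)). nra. }
  assert (hdisj : forall k, (M ^ S k + len k <= M ^ S (S k))%nat).
  { intros k. apply INR_le. rewrite plus_INR.
    replace (INR (M ^ S (S k))) with (INR M * INR (M ^ S k)) by (rewrite <- mult_INR; reflexivity).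
    specialize (hlenM k). specialize (hP (S k)).
    apply Rmult_le_reg_r with al; [exact hal |]. nra. }
  set (o := blocks M len e).
  exists (block_digits L o).
  assert (hincl : forall i, incl (block_digits L o i) L).
  { intros i d. unfold block_digits. destruct (o i) as [d' |] eqn:ho; [| auto].
    intros [<- | []]. apply blocks_values in ho. destruct ho as [j ->]. apply he1. }
  split; [| split; [exact hincl | split]].
  - intros i. split; [| split].
    + unfold block_digits. destruct (o i); [discriminate |].
      intros ->. simpl in hL3. lia.
    + unfold block_digits. destruct (o i); [| exact hL1].
      constructor; [intros [] | constructor].
    + intros k hk. apply hL2, (hincl i), hk.
  - intros k x hk hx j. set (n := (M ^ S j)%nat).
    assert (hblk : horner a k (n + len j) = (horner a k n * a ^ len j + horner a e (len j))%nat).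
    { apply horner_block. intros r hr. specialize (hk (n + r)%nat).
      unfold block_digits, o, n in hk. rewrite blocks_inside in hk by auto.
      destruct hk as [hk | []]. symmetry. exact hk. }
    pose proof (hx (n + len j)%nat) as h1. rewrite hblk in h1.
    pose proof (he2 (len j)) as h2.
    rewrite plus_INR, mult_INR, pow_INR, pow_add in h1.
    assert (hpl : 0 < INR a ^ len j) by (apply pow_lt; lra).
    (* Once the integer formed by the digits before the block is removed, a^n x and [x0] lie in the
       same cell of level [len j]. *)
    eapply Rle_lt_trans; [apply (dnint_le_dist _ (Z.of_nat (horner a k n))) |].
    rewrite <- INR_IZR_INZ.
    apply Rle_lt_trans with (/ INR a ^ len j).
    + apply Rabs_le.
      assert (hi : INR a ^ len j * / INR a ^ len j = 1) by (apply Rinv_r; lra).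
      split; apply Rmult_le_reg_l with (INR a ^ len j); try lra; nra.
    + rewrite inv_pow_exp_ln by lra. apply exp_increasing. fold al.
      specialize (hlen' j). fold n in hlen'. lra.
  - intros J rate m hm hmJ. rewrite weight_block_digits by lia. apply exp_le.
    set (lA := ln (INR (length L))).
    assert (hlA : 0 < lA) by (apply ln_pos; lra).
    apply Ropp_le_contravar.
    set (cnt := lsum (forced o) (seq 0 m)).
    replace (lA * (INR m - cnt)) with (lA / al * (INR m * al - cnt * al)) by (field; lra).
    apply Rmult_le_compat_l.
    { left. apply Rmult_lt_0_compat; [lra | apply Rinv_0_lt_compat; lra]. }
    assert (hcnt : cnt <= lsum (fun k => INR (len k)) (seq 0 J)
                          + INR (Nat.min (len J) (m - M ^ S J)))
      by (apply forced_blocks_count; assumption).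
    assert (h1 : lsum (fun k => INR (len k)) (seq 0 J) * al
                 <= (s + al) * INR (M ^ S J) / (INR M - 1)).
    { apply Rle_trans with ((s + al) * lsum (fun k => INR (M ^ S k)) (seq 0 J)).
      - rewrite Rmult_comm, <- !lsum_scal. apply lsum_le. intros k _.
        rewrite Rmult_comm. apply hlenM.
      - unfold Rdiv. rewrite Rmult_assoc. apply Rmult_le_compat_l; [lra |].
        apply Rmult_le_reg_l with (INR M - 1); [lra |].
        replace ((INR M - 1) * (INR (M ^ S J) * / (INR M - 1))) with (INR (M ^ S J))
          by (field; lra).
        apply sum_powers_le. lia. }
    assert (h2 : INR (Nat.min (len J) (m - M ^ S J)) * al
       <= al + Rmin (INR (M ^ S J) * s) (Rmax 0 (rate - al * INR (M ^ S J)))).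
    { set (y := INR (Nat.min (len J) (m - M ^ S J)) * al).
      assert (y <= al + INR (M ^ S J) * s).
      { assert (hle : INR (Nat.min (len J) (m - M ^ S J)) <= INR (len J)) by (apply le_INR; lia).
        specialize (hlen' J). unfold y. nra. }
      assert (y <= Rmax 0 (rate - al * INR (M ^ S J))).
      { assert (hle : INR (Nat.min (len J) (m - M ^ S J)) <= INR (m - M ^ S J))
          by (apply le_INR; lia).
        destruct (le_lt_dec (M ^ S J) m) as [h | h].
        - rewrite minus_INR in hle by exact h.
          eapply Rle_trans; [| apply Rmax_r]. unfold y. nra.
        - eapply Rle_trans; [| apply Rmax_l]. unfold y.
          replace (m - M ^ S J)%nat with 0%nat by lia. rewrite Nat.min_0_r. simpl. lra. }
      unfold Rmin. destruct (Rle_dec _ _); lra. }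
    assert (h3 : cnt * al <= (lsum (fun k => INR (len k)) (seq 0 J)
                          + INR (Nat.min (len J) (m - M ^ S J))) * al)
      by (apply Rmult_le_compat_r; lra).
    lra.
Qed.

(** * Lower bound for the dimension *)

Lemma lsum_list_prod {S T : Type} (f : S -> R) (g : T -> R) (l : list S) (l' : list T) :
  lsum (fun p => f (fst p) * g (snd p)) (list_prod l l') = lsum f l * lsum g l'.
Proof.
  induction l as [| x l IH]; [unfold lsum; simpl; ring |].
  simpl list_prod. rewrite lsum_app, lsum_map, IH, lsum_cons. simpl fst. simpl snd.
  rewrite lsum_scal. ring.
Qed.

(** The greedy path in the product of the two trees. Mass [k] is a product of averages down to level
    [N k], where it becomes [hx k] times [hy k]; below that level it is set to 0, which keeps the
    averaging inequality. For indicators and theta < 1 the conclusion says that one of the two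
    vanishes. *)
Lemma avoiding_path (a b : nat) (Dx Dy : nat -> list nat) (hx hy : nat -> nat -> R)
  (N : nat -> nat) (theta : R) :
  digit_tree a Dx -> digit_tree b Dy ->
  (forall k X, 0 <= hx k X) -> (forall k Y, 0 <= hy k Y) -> 0 <= theta ->
  (forall n, lsum (fun k => avg a Dx (hx k) (N k) 0 0 * avg b Dy (hy k) (N k) 0 0) (seq 0 n)
             <= theta) ->
  exists kx ky : nat -> nat,
    (forall i, In (kx i) (Dx i)) /\ (forall i, In (ky i) (Dy i)) /\
    forall k, hx k (horner a kx (N k)) * hy k (horner b ky (N k)) <= theta.
Proof.
  intros hDx hDy hhx hhy hth hroot.
  destruct (greedy_path
    (fun i (p : nat * nat) => list_prod (map (fun k => (a * fst p + k)%nat) (Dx i))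
                          (map (fun k => (b * snd p + k)%nat) (Dy i)))
    (fun k i p => if (i <=? N k)%nat then
        avg a Dx (hx k) (N k - i) i (fst p) * avg b Dy (hy k) (N k - i) i (snd p) else 0)
    theta (0%nat, 0%nat)) as [path [hp0 [hp1 hp2]]].
  - intros i p. destruct (hDx i) as [h1 _]. destruct (hDy i) as [h2 _].
    destruct (Dx i); [congruence |]. destruct (Dy i); [congruence |]. discriminate.
  - intros k i p. destruct (i <=? N k)%nat; [| lra].
    apply Rmult_le_pos; apply avg_nonneg; auto.
  - intros k i p. rewrite length_prod, !length_map, mult_INR.
    destruct (hDx i) as [h1 _]. destruct (hDy i) as [h2 _].
    apply length_pos in h1. apply length_pos in h2.
    destruct (le_lt_dec (S i) (N k)) as [hi | hi].
    + replace (S i <=? N k)%nat with true by (symmetry; apply Nat.leb_le; lia).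
      replace (i <=? N k)%nat with true by (symmetry; apply Nat.leb_le; lia).
      rewrite (lsum_list_prod (avg a Dx (hx k) (N k - S i) (S i))
                 (avg b Dy (hy k) (N k - S i) (S i))), !lsum_map.
      replace (N k - i)%nat with (S (N k - S i)) by lia. simpl avg.
      apply Req_le. field. lra.
    + replace (S i <=? N k)%nat with false by (symmetry; apply Nat.leb_gt; lia).
      rewrite lsum_const, Rmult_0_r.
      apply Rmult_le_pos; [nra |]. destruct (i <=? N k)%nat; [| lra].
      apply Rmult_le_pos; apply avg_nonneg; auto.
  - intros n. eapply Rle_trans; [| apply (hroot n)]. apply lsum_le. intros k _.
    simpl. rewrite Nat.sub_0_r. lra.
  - assert (hd : forall i, exists d : nat * nat, In (fst d) (Dx i) /\ In (snd d) (Dy i) /\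
        path (S i) = ((a * fst (path i) + fst d)%nat, (b * snd (path i) + snd d)%nat)).
    { intros i. specialize (hp1 i). destruct (path (S i)) as [X Y].
      apply in_prod_iff in hp1. destruct hp1 as [hX hY].
      apply in_map_iff in hX. destruct hX as [dx [<- hdx]].
      apply in_map_iff in hY. destruct hY as [dy [<- hdy]].
      exists (dx, dy). auto. }
    destruct (fun_choice _ hd) as [d hd'].
    exists (fun i => fst (d i)), (fun i => snd (d i)).
    split; [apply hd' | split; [apply hd' |]].
    assert (hpath : forall i, path i =
      (horner a (fun i => fst (d i)) i, horner b (fun i => snd (d i)) i)).
    { induction i as [| i IH]; [exact hp0 |].
      destruct (hd' i) as [_ [_ ->]]. rewrite IH. reflexivity. }
    intros k. specialize (hp2 (N k) k). rewrite Nat.leb_refl, Nat.sub_diag, hpath in hp2.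
    exact hp2.
Qed.

Lemma scale_between (c : R) (M : nat) (rate : R) :
  0 < c -> (2 <= M)%nat -> c * INR M <= rate ->
  exists J : nat, c * INR (M ^ S J) <= rate < c * INR (M ^ S (S J)).
Proof.
  intros hc hM h0.
  assert (hex : exists n : nat, rate < c * INR (M ^ S n)).
  { destruct (nat_floor (rate / c)) as [n hn].
    { apply Rmult_le_pos; [| left; apply Rinv_0_lt_compat; lra].
      pose proof (pos_INR M). nra. }
    exists n. replace rate with (c * (rate / c)) by (field; lra).
    apply Rmult_lt_compat_l; [exact hc |].
    assert (h : (S n <= M ^ S n)%nat) by (pose proof (pow_ge_index M (S n) hM); lia).
    apply le_INR in h. rewrite S_INR in h. lra. }
  destruct hex as [n hn]. induction n as [| n IH].
  - simpl in hn. rewrite Nat.mul_1_r in hn. lra.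
  - destruct (Rlt_le_dec rate (c * INR (M ^ S n))) as [h | h]; [auto |].
    exists n. split; assumption.
Qed.

(* Since [rpow 0 sg = 0], sets of diameter [0] are free in a cover; here they get a
   positive scale at an arbitrarily small total cost. *)
Lemma positive_rates (sg R0 eps : R) (r : nat -> R) :
  0 < sg -> 0 < eps -> (forall n, 0 <= r n <= exp (- R0)) ->
  exists rate : nat -> R, forall n, R0 <= rate n /\ r n <= exp (- rate n) /\
    exp (- (sg * rate n)) <= rpow (r n) sg + eps / 2 * (1 / 2) ^ n.
Proof.
  intros hsg heps hr.
  apply (fun_choice (fun n x => R0 <= x /\ r n <= exp (- x) /\
    exp (- (sg * x)) <= rpow (r n) sg + eps / 2 * (1 / 2) ^ n)).
  intros n. specialize (hr n).
  assert (hq : 0 < eps / 2 * (1 / 2) ^ n).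
  { apply Rmult_lt_0_compat; [lra | apply pow_lt; lra]. }
  destruct (Req_dec (r n) 0) as [h0 | h0].
  - set (y := - (ln (eps / 2 * (1 / 2) ^ n) / sg)).
    exists (Rmax R0 y). pose proof (Rmax_l R0 y). pose proof (Rmax_r R0 y) as hy.
    split; [assumption | split; [rewrite h0; left; apply exp_pos |]].
    pose proof (rpow_nonneg (r n) sg).
    assert (exp (- (sg * Rmax R0 y)) <= eps / 2 * (1 / 2) ^ n); [| lra].
    rewrite <- (exp_ln (eps / 2 * (1 / 2) ^ n)) by exact hq. apply exp_le.
    assert (hsy : sg * y = - ln (eps / 2 * (1 / 2) ^ n)) by (unfold y; field; lra).
    apply Rmult_le_compat_l with (r := sg) in hy; lra.
  - exists (- ln (r n)). rewrite Ropp_involutive, exp_ln by lra.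
    split; [| split; [lra |]].
    + rewrite <- (Ropp_involutive R0). apply Ropp_le_contravar.
      rewrite <- (ln_exp (- R0)).
      destruct (proj2 hr) as [h | ->]; [left; apply ln_increasing; lra | lra].
    + unfold rpow. destruct (Req_EM_T (r n) 0); [contradiction |]. unfold Rpower.
      replace (- (sg * - ln (r n))) with (sg * ln (r n)) by ring. lra.
Qed.

(** The hypothesis on [D] is a lower bound for the local exponent of the product mass: [n] is the
    start of the current block, e^-rate the scale, and the two [Rmin] are the forced parts. If D >
    sg, a cheap cover of exponent [sg] would miss a point of the Cantor subset. *)
Lemma Mc_dim_ge (a b : nat) (La Lb : list nat) (Ca Cb : R -> Prop) (xo yo s1 s2 D sg : R) :
  (2 <= a)%nat -> (2 <= b)%nat -> digit_set a La -> digit_set b Lb ->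
  is_attractor a La Ca -> is_attractor b Lb Cb -> Ca xo -> Cb yo ->
  0 <= s1 -> 0 <= s2 -> 0 < sg ->
  (forall n rate, 0 <= n -> 0 <= rate ->
     D * rate <=
       ln (INR (length La)) / ln (INR a)
         * (rate - Rmin (n * s1) (Rmax 0 (rate - ln (INR a) * n)))
     + ln (INR (length Lb)) / ln (INR b)
         * (rate - Rmin (n * s2) (Rmax 0 (rate - ln (INR b) * n)))) ->
  Hs_null sg (Mc a b Ca Cb xo yo (s1 + s2)) -> D <= sg.
Proof.
  intros ha hb hLa hLb hCa hCb hxo hyo hs1 hs2 hsg hD hnull.
  apply Rnot_lt_le. intros hlt.
  pose proof (INR_gt_1 a ha) as ha1. pose proof (INR_gt_1 b hb) as hb1.
  pose proof (ln_pos _ ha1) as hal. pose proof (ln_pos _ hb1) as hbl.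
  assert (hA : 2 <= INR (length La)) by (destruct hLa as [_ [_ h]]; apply le_INR in h; exact h).
  assert (hB : 2 <= INR (length Lb)) by (destruct hLb as [_ [_ h]]; apply le_INR in h; exact h).
  pose proof (side_tree a La Ca xo s1) as treex.
  pose proof (side_tree b Lb Cb yo s2) as treey.
  set (al := ln (INR a)) in *. set (be := ln (INR b)) in *.
  set (d1 := ln (INR (length La)) / al) in *. set (d2 := ln (INR (length Lb)) / be) in *.
  assert (hd1 : 0 < d1).
  { apply Rmult_lt_0_compat; [apply ln_pos; lra | apply Rinv_0_lt_compat; lra]. }
  assert (hd2 : 0 < d2).
  { apply Rmult_lt_0_compat; [apply ln_pos; lra | apply Rinv_0_lt_compat; lra]. }
  set (c0 := Rmin al be).
  assert (hc0 : 0 < c0) by (apply Rmin_glb_lt; lra).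
  assert (hc0a : c0 <= al) by apply Rmin_l. assert (hc0b : c0 <= be) by apply Rmin_r.
  set (kap := d1 * (s1 + al) + d2 * (s2 + be)).
  assert (hkap : 0 < kap) by (unfold kap; nra).
  (* The first two bounds make the blocks fit. The third absorbs the older blocks: they cost kap n /
     (M - 1), and a set of the cover at [rate] is assigned to the [n] with c0 n <= rate < c0 M n, so
     this is at most (D - sg) rate. *)
  assert (hM : exists M : nat, (2 <= M)%nat /\ s1 + al <= (INR M - 1) * al /\
     s2 + be <= (INR M - 1) * be /\ kap <= (INR M - 1) * (c0 * (D - sg))).
  { set (x1 := (s1 + al) / al). set (x2 := (s2 + be) / be). set (x3 := kap / (c0 * (D - sg))).
    assert (hcd : 0 < c0 * (D - sg)) by nra.
    assert (h1 : 0 <= x1) by (apply Rmult_le_pos; [lra | left; apply Rinv_0_lt_compat; lra]).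
    assert (h2 : 0 <= x2) by (apply Rmult_le_pos; [lra | left; apply Rinv_0_lt_compat; lra]).
    assert (h3 : 0 <= x3) by (apply Rmult_le_pos; [lra | left; apply Rinv_0_lt_compat; lra]).
    destruct (nat_floor (x1 + x2 + x3)) as [M hM]; [lra |].
    exists (S (S M)). rewrite !S_INR. split; [lia |].
    replace (s1 + al) with (x1 * al) by (unfold x1; field; lra).
    replace (s2 + be) with (x2 * be) by (unfold x2; field; lra).
    replace kap with (x3 * (c0 * (D - sg))) by (unfold x3; field; lra).
    repeat split; apply Rmult_le_compat_r; lra. }
  destruct hM as [M [hM2 [hMa [hMb hMk]]]].
  assert (hM1 : 2 <= INR M) by (apply le_INR in hM2; exact hM2).
  destruct (treex M) as [Dx [hDx [hDxL [hDxn hDxw]]]]; auto.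
  destruct (treey M) as [Dy [hDy [hDyL [hDyn hDyw]]]]; auto.
  clear treex treey.
  set (cst := 2 * d1 * al + 2 * d2 * be).
  set (R0 := c0 * INR M). assert (hR0 : 0 < R0) by (unfold R0; nra).
  (* Each set has mass at most 16 e^cst e^(-sg rate), where 16 = 4 * 4 counts neighbouring cells and
     [cst] collects the roundings. The replaced costs sum to at most 2 eps, so the total mass is at
     most 1/2. The bound e^(-R0) on the radii makes every rate at least c0 M, the scale of the first
     block. *)
  set (eps := / (64 * exp cst)).
  assert (heps : 0 < eps).
  { apply Rinv_0_lt_compat. pose proof (exp_pos cst). lra. }
  destruct (hnull (exp (- R0)) (exp_pos _) eps heps) as [U [r [l [hU1 [hU2 [hU3 hU4]]]]]].
  destruct (positive_rates sg R0 eps r hsg heps) as [rate hrate]; [intros n; apply hU2 |].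
  assert (hr0 : forall k, 0 <= rate k) by (intros k; destruct (hrate k); lra).
  destruct (fun_choice _ (fun k => pow_floor a (rate k) ha (hr0 k))) as [mx hmx].
  destruct (fun_choice _ (fun k => pow_floor b (rate k) hb (hr0 k))) as [my hmy].
  fold al in hmx. fold be in hmy.
  (* [U k] is enlarged to the product of its projections. Their masses are estimated at the levels
     [mx k] and [my k] fitting its size, but the branch is tested at a common level below both. *)
  set (N := fun k => Nat.max (mx k) (my k)).
  set (Ux := fun k x => exists y, U k (x, y)).
  set (Uy := fun k y => exists x, U k (x, y)).
  assert (hUd : forall k p q, U k p -> U k q ->
    Rabs (fst p - fst q) <= exp (- rate k) /\ Rabs (snd p - snd q) <= exp (- rate k)).
  { intros k p q hp hq. destruct (hU2 k) as [_ hdiam]. specialize (hdiam p q hp hq).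
    destruct (hrate k) as [_ [hrk _]].
    assert (hd : dist2 p q <= exp (- rate k)) by lra. unfold dist2 in hd.
    split; (eapply Rle_trans; [| exact hd]); rewrite <- sqrt_Rsqr_abs;
      apply sqrt_le_1_alt; unfold Rsqr;
      pose proof (pow2_ge_0 (fst p - fst q)); pose proof (pow2_ge_0 (snd p - snd q)); lra. }
  assert (hmass : forall k,
    avg a Dx (fun X => indic (meets a (Ux k) (N k) X)) (N k) 0 0 *
    avg b Dy (fun Y => indic (meets b (Uy k) (N k) Y)) (N k) 0 0
      <= 16 * exp cst * exp (- (sg * rate k))).
  { intros k. destruct (hrate k) as [hrk0 _].
    destruct (scale_between c0 M (rate k) hc0 hM2 hrk0) as [J hJ].
    pose proof (hmx k) as hmxk. pose proof (hmy k) as hmyk.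
    assert (hwx : avg a Dx (fun X => indic (meets a (Ux k) (N k) X)) (N k) 0 0
                  <= 4 * weight Dx 0 (mx k)).
    { apply avg_meets_small; [exact ha | exact hDx | unfold N; lia |].
      intros x x' [y hxy] [y' hxy']. destruct (hUd k _ _ hxy hxy') as [h _].
      eapply Rle_trans; [exact h |]. rewrite inv_pow_exp_ln by lra. apply exp_le.
      fold al. lra. }
    assert (hwy : avg b Dy (fun Y => indic (meets b (Uy k) (N k) Y)) (N k) 0 0
                  <= 4 * weight Dy 0 (my k)).
    { apply avg_meets_small; [exact hb | exact hDy | unfold N; lia |].
      intros x x' [y hxy] [y' hxy']. destruct (hUd k _ _ hxy hxy') as [_ h].
      eapply Rle_trans; [exact h |]. rewrite inv_pow_exp_ln by lra. apply exp_le.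
      fold be. lra. }
    pose proof (pos_INR (M ^ S (S J))) as hP.
    assert (hmJ : (mx k <= M ^ S (S J))%nat).
    { apply INR_le. apply Rmult_le_reg_r with al; [exact hal |]. nra. }
    assert (hmJ' : (my k <= M ^ S (S J))%nat).
    { apply INR_le. apply Rmult_le_reg_r with be; [exact hbl |]. nra. }
    specialize (hDxw J (rate k) (mx k) hmxk hmJ).
    specialize (hDyw J (rate k) (my k) hmyk hmJ').
    assert (h0x : 0 <= avg a Dx (fun X => indic (meets a (Ux k) (N k) X)) (N k) 0 0)
      by (apply avg_nonneg; [exact hDx | intros; apply indic_bounds]).
    assert (h0y : 0 <= avg b Dy (fun X => indic (meets b (Uy k) (N k) X)) (N k) 0 0)
      by (apply avg_nonneg; [exact hDy | intros; apply indic_bounds]).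
    eapply Rle_trans; [apply Rmult_le_compat; [exact h0x | exact h0y | |] |].
    { eapply Rle_trans; [exact hwx |]. apply Rmult_le_compat_l; [lra | exact hDxw]. }
    { eapply Rle_trans; [exact hwy |]. apply Rmult_le_compat_l; [lra | exact hDyw]. }
    match goal with |- 4 * exp ?u * (4 * exp ?v) <= _ =>
      replace (4 * exp u * (4 * exp v)) with (16 * exp (u + v)) by (rewrite exp_plus; ring) end.
    rewrite Rmult_assoc, <- exp_plus. apply Rmult_le_compat_l; [lra |]. apply exp_le.
    set (n := INR (M ^ S J)) in *.
    assert (hn : 0 <= n) by apply pos_INR.
    specialize (hD n (rate k) hn (hr0 k)).
    assert (hk : kap * n / (INR M - 1) <= (D - sg) * rate k).
    { apply Rmult_le_reg_r with (INR M - 1); [lra |].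
      replace (kap * n / (INR M - 1) * (INR M - 1)) with (kap * n) by (field; lra).
      apply Rle_trans with ((INR M - 1) * (c0 * (D - sg)) * n).
      - apply Rmult_le_compat_r; lra.
      - replace ((INR M - 1) * (c0 * (D - sg)) * n) with ((c0 * n) * ((D - sg) * (INR M - 1)))
          by ring.
        replace ((D - sg) * rate k * (INR M - 1)) with (rate k * ((D - sg) * (INR M - 1))) by ring.
        apply Rmult_le_compat_r; [nra | lra]. }
    set (mnx := Rmin (n * s1) (Rmax 0 (rate k - al * n))) in *.
    set (mny := Rmin (n * s2) (Rmax 0 (rate k - be * n))) in *.
    assert (hk2 : kap * n / (INR M - 1) = d1 * ((s1 + al) * n / (INR M - 1))
                                          + d2 * ((s2 + be) * n / (INR M - 1)))
      by (unfold kap; field; lra).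
    set (e1 := (s1 + al) * n / (INR M - 1)) in *.
    set (e2 := (s2 + be) * n / (INR M - 1)) in *.
    unfold cst. lra. }
  destruct (avoiding_path a b Dx Dy
    (fun k X => indic (meets a (Ux k) (N k) X)) (fun k Y => indic (meets b (Uy k) (N k) Y))
    N (1 / 2)) as [kx [ky [hkx [hky hav]]]]; auto.
  { intros; apply indic_bounds. } { intros; apply indic_bounds. } { lra. }
  { intros n. apply Rle_trans with (lsum (fun k => 16 * exp cst *
        (rpow (r k) sg + eps / 2 * (1 / 2) ^ k)) (seq 0 n)).
    - apply lsum_le. intros k _. eapply Rle_trans; [apply hmass |].
      apply Rmult_le_compat_l; [pose proof (exp_pos cst); lra | apply hrate].
    - rewrite lsum_scal, lsum_plus.
      assert (h1 : lsum (fun k => rpow (r k) sg) (seq 0 n) <= l).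
      { apply Rle_trans with (lsum (fun k => rpow (r k) sg) (seq 0 (S n))).
        - apply lsum_seq_mono; [intros; apply rpow_nonneg | lia].
        - rewrite <- sum_f_R0_lsum. apply sum_incr; [exact hU3 | intros; apply rpow_nonneg]. }
      assert (h2 : lsum (fun k => eps / 2 * (1 / 2) ^ k) (seq 0 n) <= eps).
      { eapply Rle_trans; [apply (lsum_geom (eps / 2) (1 / 2) 0 n); lra |].
        simpl. apply Req_le. field. }
      apply Rle_trans with (16 * exp cst * (2 * eps)).
      + apply Rmult_le_compat_l; [pose proof (exp_pos cst); lra | lra].
      + unfold eps. apply Req_le. field. apply Rgt_not_eq, exp_pos. }
  destruct (attractor_limit a La Ca kx) as [x [hxC hx]]; auto.
  { apply hLa. } { intros i. apply (hDxL i), hkx. }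
  destruct (attractor_limit b Lb Cb ky) as [y [hyC hy]]; auto.
  { apply hLb. } { intros i. apply (hDyL i), hky. }
  destruct (hU1 (x, y)) as [k hk].
  { split; [exact hxC | split; [exact hyC |]]. intros n0. exists (M ^ S n0)%nat.
    split; [pose proof (pow_ge_index M (S n0) hM2); lia |]. simpl fst. simpl snd.
    replace (- (INR (M ^ S n0) * (s1 + s2))) with
      (- (INR (M ^ S n0) * s1) + - (INR (M ^ S n0) * s2)) by ring.
    rewrite exp_plus. apply Rmult_le_0_lt_compat; try apply dnint_nonneg.
    - exact (hDxn kx x hkx hx n0).
    - exact (hDyn ky y hky hy n0). }
  specialize (hav k). rewrite !indic_true in hav; [lra | |].
  - exists y. split; [exists x; exact hk | apply hy].
  - exists x. split; [exists y; exact hk | apply hx].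
Qed.

(** * Comparison of the exponents *)

Lemma Rmax_bound_mult (d1 d2 al be t : R) :
  0 < al -> 0 < be -> 0 < t ->
  let F := Rmax (d1 + d2 * be / (t + be)) (d2 + d1 * al / (t + al)) in
  d1 * (t + be) + d2 * be <= F * (t + be) /\ d2 * (t + al) + d1 * al <= F * (t + al).
Proof.
  intros hal hbe ht F. split.
  - replace (d1 * (t + be) + d2 * be) with ((d1 + d2 * be / (t + be)) * (t + be)) by (field; lra).
    apply Rmult_le_compat_r; [lra | apply Rmax_l].
  - replace (d2 * (t + al) + d1 * al) with ((d2 + d1 * al / (t + al)) * (t + al)) by (field; lra).
    apply Rmult_le_compat_r; [lra | apply Rmax_r].
Qed.

(** As a function of [s], the quotient of the two sides' factors has derivative of the sign of d2 be
    - d1 (t + be), which is negative as d2 <= d1. So s = 0 is the worst case, and this is the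
    hypothesis. *)
Lemma exponent_below_b (d1 d2 be t s F : R) :
  0 < be -> 0 < t -> 0 < d1 -> 0 < d2 -> d2 <= d1 -> 0 <= s <= t ->
  d1 * (t + be) + d2 * be <= F * (t + be) ->
  d1 * (be + t - 2 * s) + d2 * be <= F * (be + t - s).
Proof.
  intros hbe ht hd1 hd2 hd hs hF.
  apply Rmult_le_reg_r with (t + be); [lra |].
  apply Rle_trans with ((d1 * (t + be) + d2 * be) * (be + t - s)).
  - assert (0 <= s * (d1 * (t + be) - d2 * be)).
    { apply Rmult_le_pos; [lra |]. nra. }
    lra.
  - replace (F * (be + t - s) * (t + be)) with (F * (t + be) * (be + t - s)) by ring.
    apply Rmult_le_compat_r; lra.
Qed.

(** When rho = al + s, the exponent is monotone in [s] with the sign of d2 (t + al) - d1 al. If it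
    is nondecreasing, its maximum is at s = t, the second term of F. Otherwise it is largest at the
    balanced [s0], which is nonnegative because al <= t + be and also belongs to the range of
    [exponent_below_b]. *)
Lemma upper_exponent (d1 d2 al be t s : R) :
  0 < al -> 0 < be -> 0 < t -> 0 < d1 -> 0 < d2 -> d2 <= d1 -> 0 <= s <= t ->
  (al <= t + be \/ d1 * al <= d2 * (t + al)) ->
  let rho := Rmax (al + s) (be + t - s) in
  d1 * (rho - s) + d2 * (rho - t + s)
    <= Rmax (d1 + d2 * be / (t + be)) (d2 + d1 * al / (t + al)) * rho.
Proof.
  intros hal hbe ht hd1 hd2 hd hs hcase rho.
  destruct (Rmax_bound_mult d1 d2 al be t hal hbe ht) as [hFb hFa].
  set (F := Rmax (d1 + _) _) in *. unfold rho.
  destruct (Rle_lt_dec (al + s) (be + t - s)) as [h | h].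
  - rewrite Rmax_right by exact h.
    pose proof (exponent_below_b d1 d2 be t s F hbe ht hd1 hd2 hd hs hFb). lra.
  - rewrite Rmax_left by lra.
    destruct (Rle_lt_dec (d1 * al) (d2 * (t + al))) as [h' | h'].
    + apply Rmult_le_reg_r with (t + al); [lra |].
      apply Rle_trans with ((d2 * (t + al) + d1 * al) * (al + s)).
      * assert (0 <= (t - s) * (d2 * (t + al) - d1 * al)) by (apply Rmult_le_pos; lra). lra.
      * replace (F * (al + s) * (t + al)) with (F * (t + al) * (al + s)) by ring.
        apply Rmult_le_compat_r; lra.
    + assert (hab : al <= t + be) by (destruct hcase; lra).
      (* The exponent decreases in s from the balanced value s0, where both sides
         have length e^(-n r0). *)
      set (s0 := (be + t - al) / 2). set (r0 := (al + be + t) / 2).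
      assert (h0 : d1 * (be + t - 2 * s0) + d2 * be <= F * (be + t - s0)).
      { apply (exponent_below_b d1 d2 be t s0 F); auto. unfold s0. lra. }
      replace (be + t - s0) with r0 in h0 by (unfold s0, r0; field).
      replace (be + t - 2 * s0) with al in h0 by (unfold s0; field).
      assert (hr0 : 0 < r0) by (unfold r0; lra).
      apply Rmult_le_reg_r with r0; [exact hr0 |].
      apply Rle_trans with ((d1 * al + d2 * be) * (al + s)).
      * assert (0 <= (s - s0) * (d1 * al - d2 * (t + al))).
        { apply Rmult_le_pos; [unfold s0 |]; lra. }
        unfold s0, r0 in *. lra.
      * replace (F * (al + s) * r0) with (F * r0 * (al + s)) by ring.
        apply Rmult_le_compat_r; lra.
Qed.

(** Add the bounds n s and rate - c n with weights [c] and [s]. Equality holds at the end of the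
    block, rate = (s + c) n, where the forced proportion is largest. *)
Lemma loss_le (n s c rate : R) :
  0 <= s -> 0 < c -> 0 <= rate ->
  Rmin (n * s) (Rmax 0 (rate - c * n)) * (s + c) <= s * rate.
Proof.
  intros hs hc hr. set (m := Rmin _ _).
  assert (h1 : m <= n * s) by apply Rmin_l.
  assert (h2 : m <= Rmax 0 (rate - c * n)) by apply Rmin_r.
  destruct (Rle_lt_dec (rate - c * n) 0) as [h | h].
  - rewrite Rmax_left in h2 by exact h. assert (0 <= s * rate) by (apply Rmult_le_pos; lra). nra.
  - rewrite Rmax_right in h2 by lra. nra.
Qed.

Lemma loss_le_frac (n s c rate : R) :
  0 <= s -> 0 < c -> 0 <= rate ->
  Rmin (n * s) (Rmax 0 (rate - c * n)) <= s * rate / (s + c).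
Proof.
  intros hs hc hr. apply Rmult_le_reg_r with (s + c); [lra |].
  replace (s * rate / (s + c) * (s + c)) with (s * rate) by (field; lra).
  apply loss_le; assumption.
Qed.

Lemma loss_zero (n c rate : R) : Rmin (n * 0) (Rmax 0 (rate - c * n)) = 0.
Proof. rewrite Rmult_0_r. apply Rmin_left, Rmax_l. Qed.

Lemma interior_rate (d1 d2 al be t : R) :
  0 < al -> 0 < be -> 0 < t -> 0 < d1 -> 0 < d2 ->
  t + be < al -> d2 * (t + al) < d1 * al ->
  exists s D, 0 <= s <= t /\
    Rmax (d1 + d2 * be / (t + be)) (d2 + d1 * al / (t + al)) < D /\
    forall n rate, 0 <= n -> 0 <= rate ->
      D * rate <= d1 * (rate - Rmin (n * s) (Rmax 0 (rate - al * n)))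
                + d2 * (rate - Rmin (n * (t - s)) (Rmax 0 (rate - be * n))).
Proof.
  intros hal hbe ht hd1 hd2 hab hd.
  (* The numerator of the difference between the local exponents at the scales be + t - s and al +
     s, so that a zero makes them equal. *)
  set (g := fun s => (d2 * be + d1 * (be + t - s)) * (al + s)
                     - (d1 * al + d2 * (al + 2 * s - t)) * (be + t - s)).
  assert (hg : continuity g) by (unfold g; reg).
  assert (hg0 : g 0 < 0).
  { unfold g. assert (0 < d2 * t * (al - be - t)) by (repeat apply Rmult_lt_0_compat; lra). lra. }
  assert (hgt : 0 < g t).
  { unfold g. assert (0 < d1 * be * t) by (repeat apply Rmult_lt_0_compat; lra). lra. }
  destruct (IVT g 0 t hg ht hg0 hgt) as [s [hs hgs]].
  assert (hs0 : 0 < s).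
  { destruct (proj1 hs) as [h | h]; [exact h |]. rewrite <- h in hgs. lra. }
  assert (hst : s < t).
  { destruct (proj2 hs) as [h | h]; [exact h |]. rewrite h in hgs. lra. }
  set (D := d1 + d2 * be / (be + t - s)).
  assert (hDb : D * (be + t - s) = d1 * (be + t - s) + d2 * be) by (unfold D; field; lra).
  assert (hDa : D * (al + s) = d1 * al + d2 * (al + 2 * s - t)).
  { apply Rmult_eq_reg_r with (be + t - s); [| lra].
    replace (D * (al + s) * (be + t - s)) with (D * (be + t - s) * (al + s)) by ring.
    rewrite hDb. unfold g in hgs. lra. }
  assert (hD2 : d2 + d1 * al / (t + al) < D).
  { apply Rmult_lt_reg_r with ((t + al) * (al + s)); [apply Rmult_lt_0_compat; lra |].
    replace ((d2 + d1 * al / (t + al)) * ((t + al) * (al + s)))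
      with ((d2 * (t + al) + d1 * al) * (al + s)) by (field; lra).
    replace (D * ((t + al) * (al + s))) with (D * (al + s) * (t + al)) by ring.
    rewrite hDa.
    assert (0 < (t - s) * (d1 * al - d2 * (t + al))) by (apply Rmult_lt_0_compat; lra). lra. }
  assert (hdd2 : d2 < D).
  { assert (0 < d1 * al / (t + al)); [| lra].
    apply Rmult_lt_0_compat; [nra | apply Rinv_0_lt_compat; lra]. }
  exists s, D. split; [lra | split].
  - apply Rmax_lub_lt; [| exact hD2]. unfold D. apply Rplus_lt_compat_l.
    apply Rmult_lt_compat_l; [nra |]. apply Rinv_lt_contravar; [nra | lra].
  - intros n rate hn hr.
    set (mx := Rmin (n * s) (Rmax 0 (rate - al * n))).
    set (my := Rmin (n * (t - s)) (Rmax 0 (rate - be * n))).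
    (* Three ranges: before the x-block starts only the y-block costs, and [loss_le] applies; past
       both blocks the loss is constant and the exponent grows; in between, the scale lies inside
       the x-block. *)
    destruct (Rle_lt_dec rate (al * n)) as [h | h].
    + assert (hmx : mx <= 0).
      { eapply Rle_trans; [apply Rmin_r |]. rewrite Rmax_left; lra. }
      assert (hmy : my * ((t - s) + be) <= (t - s) * rate) by (apply loss_le; lra).
      apply Rmult_le_reg_r with (be + t - s); [lra |].
      replace (D * rate * (be + t - s)) with (D * (be + t - s) * rate) by ring.
      rewrite hDb.
      assert (0 <= d1 * - mx * (be + t - s)) by (repeat apply Rmult_le_pos; lra).
      assert (d2 * (my * ((t - s) + be)) <= d2 * ((t - s) * rate))
        by (apply Rmult_le_compat_l; lra).
      lra.
    + assert (hmy : my <= n * (t - s)) by apply Rmin_l.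
      assert (hd2my : d2 * my <= d2 * (n * (t - s))) by (apply Rmult_le_compat_l; lra).
      destruct (Rle_lt_dec ((al + s) * n) rate) as [h' | h'].
      * assert (hmx : mx <= n * s) by apply Rmin_l.
        assert (hd1mx : d1 * mx <= d1 * (n * s)) by (apply Rmult_le_compat_l; lra).
        assert (hE : 0 <= (d1 * s + d2 * (t - s)) * (rate - (al + s) * n)).
        { apply Rmult_le_pos; [| lra].
          apply Rplus_le_le_0_compat; apply Rmult_le_pos; lra. }
        apply Rle_trans with (d1 * (rate - n * s) + d2 * (rate - n * (t - s))); [| lra].
        apply Rmult_le_reg_r with (al + s); [lra |].
        replace (D * rate * (al + s)) with (D * (al + s) * rate) by ring.
        rewrite hDa. lra.
      * assert (hmx : mx <= rate - al * n).
        { eapply Rle_trans; [apply Rmin_r |]. rewrite Rmax_right; lra. }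
        assert (hd1mx : d1 * mx <= d1 * (rate - al * n)) by (apply Rmult_le_compat_l; lra).
        (* Inside the x-block only [y] gains free digits, so the right side grows with slope d2 < D.
           The inequality is tightest at the end rate = (al + s) n, where it is [hDa]. *)
        assert (hE : 0 <= (D - d2) * ((al + s) * n - rate)) by (apply Rmult_le_pos; lra).
        assert (hn' : D * (al + s) * n = (d1 * al + d2 * (al + 2 * s - t)) * n)
          by (rewrite hDa; reflexivity).
        lra.
Qed.

Theorem mainTheorem13
  (a b : nat) (La Lb : list nat) (Ca Cb : R -> Prop) (xo yo t : R)
  (ha : (3 <= a)%nat) (hb : (3 <= b)%nat)
  (hLa : digit_set a La) (hLb : digit_set b Lb)
  (hCa : is_attractor a La Ca) (hCb : is_attractor b Lb Cb)
  (hxo : Ca xo) (hyo : Cb yo)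
  (hdelta : ln (INR (length Lb)) / ln (INR b) <= ln (INR (length La)) / ln (INR a))
  (ht : 0 < t) :
  let d1 := ln (INR (length La)) / ln (INR a) in
  let d2 := ln (INR (length Lb)) / ln (INR b) in
  let F := Rmax (d1 + d2 * ln (INR b) / (t + ln (INR b)))
                (d2 + d1 * ln (INR a) / (t + ln (INR a))) in
  ( ( (a <= b)%nat
      \/ ((b < a)%nat /\ ln (INR a) <= t + ln (INR b))
      \/ ((b < a)%nat /\ t + ln (INR b) < ln (INR a)
          /\ d1 * ln (INR a) <= d2 * (t + ln (INR a))) ) ->
    hausdorff_dim (Mc a b Ca Cb xo yo t) F )
  /\
  ( ((b < a)%nat /\ t + ln (INR b) < ln (INR a)
      /\ d2 * (t + ln (INR a)) < d1 * ln (INR a)) ->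
    ~ hausdorff_dim (Mc a b Ca Cb xo yo t) F ).
Proof.
  intros d1 d2 F.
  assert (ha2 : (2 <= a)%nat) by lia. assert (hb2 : (2 <= b)%nat) by lia.
  pose proof (INR_gt_1 a ha2) as ha1. pose proof (INR_gt_1 b hb2) as hb1.
  pose proof (ln_pos _ ha1) as hal. pose proof (ln_pos _ hb1) as hbl.
  pose proof (fun s1 s2 D sg => Mc_dim_ge a b La Lb Ca Cb xo yo s1 s2 D sg
    ha2 hb2 hLa hLb hCa hCb hxo hyo) as lower. fold d1 d2 in lower.
  assert (hA : 2 <= INR (length La)) by (destruct hLa as [_ [_ h]]; apply le_INR in h; exact h).
  assert (hB : 2 <= INR (length Lb)) by (destruct hLb as [_ [_ h]]; apply le_INR in h; exact h).
  assert (hd1 : 0 < d1).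
  { apply Rmult_lt_0_compat; [apply ln_pos; lra | apply Rinv_0_lt_compat; lra]. }
  assert (hd2 : 0 < d2).
  { apply Rmult_lt_0_compat; [apply ln_pos; lra | apply Rinv_0_lt_compat; lra]. }
  split.
  - intros hcase.
    assert (hcase' : ln (INR a) <= t + ln (INR b)
                     \/ d1 * ln (INR a) <= d2 * (t + ln (INR a))).
    { destruct hcase as [h | [[_ h] | [_ [_ h]]]]; [left | left; exact h | right; exact h].
      apply le_INR in h. assert (ln (INR a) <= ln (INR b)); [| lra].
      destruct h as [h | ->]; [left; apply ln_increasing; lra | lra]. }
    split.
    + intros s hs hnull. apply Rmax_lub.
      * apply (lower 0 t); [lra | lra | exact hs | | rewrite Rplus_0_l; exact hnull].
        intros n rate hn hr. rewrite loss_zero.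
        pose proof (loss_le_frac n t (ln (INR b)) rate ltac:(lra) hbl hr) as h.
        apply Rmult_le_compat_l with (r := d2) in h; [| lra].
        replace ((d1 + d2 * ln (INR b) / (t + ln (INR b))) * rate)
          with (d1 * rate + d2 * (rate - t * rate / (t + ln (INR b)))) by (field; lra).
        lra.
      * apply (lower t 0); [lra | lra | exact hs | | rewrite Rplus_0_r; exact hnull].
        intros n rate hn hr. rewrite loss_zero.
        pose proof (loss_le_frac n t (ln (INR a)) rate ltac:(lra) hal hr) as h.
        apply Rmult_le_compat_l with (r := d1) in h; [| lra].
        replace ((d2 + d1 * ln (INR a) / (t + ln (INR a))) * rate)
          with (d2 * rate + d1 * (rate - t * rate / (t + ln (INR a)))) by (field; lra).
        lra.
    + intros d' hd'. apply Rnot_lt_le. intros hlt.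
      assert (hF : 0 < F).
      { eapply Rlt_le_trans; [| apply Rmax_l].
        assert (0 < d2 * ln (INR b) / (t + ln (INR b))); [| lra].
        apply Rmult_lt_0_compat; [nra | apply Rinv_0_lt_compat; lra]. }
      assert (h : d' <= (F + d') / 2); [| lra].
      apply hd'; [lra |].
      apply (Hs_null_Mc a b La Lb Ca Cb xo yo t F); auto; [| lra].
      intros s hs. apply upper_exponent; auto.
  (* [D] bounds from below every exponent with null measure, so the greatest such bound cannot be F
     < D. *)
  - intros [_ [hab hd]] [_ hdim].
    destruct (interior_rate d1 d2 (ln (INR a)) (ln (INR b)) t) as [s [D [hs [hFD hD]]]]; auto.
    assert (h : D <= F); [| unfold F in h; lra].
    apply hdim. intros sg hsg hnull. apply (lower s (t - s)); auto; try lra.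
    replace (s + (t - s)) with t by ring. exact hnull.
Qed.
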